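(* Fix an integer $K\ge 1$ and $\omega>0$. Assume: 1. the sampling step $\Delta=\Delta_n$ satisfies $\max\{F_1^2(K)\, n\Delta^3,\ F_2(K)\,\Delta\}=O(1)$ as $n\to\infty$; 2. the prior distribution $\tilde\Pi_K$ on $\Theta_K\subseteq\mathbb{R}^K$ has a density function that is continuous and bounded away from $0$ in a neighborhood of $\theta_K^\perp$. Let $\varepsilon_n=t_n^{-1/2}$. Then for every deterministic sequence $M_n\to\infty$ (diverging arbitrarily slowly), the (fixed-$K$) Gibbs posterior $\Pi_n$ satisfies $$\mathsf{E}\,\Pi_n\bigl(\{\psi:\|\psi-\psi_K^\perp\|_{L_2(D)}>M_n\varepsilon_n\}\bigr)\to 0,\qquad n\to\infty .$$ In particular, if $\psi^\star\in\mathcal{S}_K$ (as a function on $D$), then the Gibbs posterior concentrates around $\psi^\star$ at rate $\varepsilon_n=t_n^{-1/2}$, i.e. $\mathsf{E}\,\Pi_n(\{\psi:\|\psi-\psi^\star\|_{L_2(D)}>M_n\varepsilon_n\})\to0$ for every such $M_n$.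
   Context: Model and sampling. $X=\{X(t):t\ge 0\}$ is a real-valued Lévy process ($X(0)=0$ a.s., independent and stationary increments, stochastically continuous, càdlàg) with law $\mathsf{P}$, expectation $\mathsf{E}$ and characteristic triplet $(\mu,\sigma,\Psi)$. The Lévy measure $\Psi$ satisfies $\int\min(x^2,1)\,\Psi(dx)<\infty$ and has a density $\psi^\star$ (the true Lévy density): $\Psi(A)=\int_A\psi^\star(x)\,dx$. For each $n$, $X$ is observed at times $t_i=i\Delta$, $i=0,\dots,n$, with $\Delta=\Delta_n>0$; thus $t_n=n\Delta$, and as $n\to\infty$ we have $\Delta_n\to0$ and $t_n\to\infty$. Put $Y_i=X(t_i)-X(t_{i-1})$, $i=1,\dots,n$ (iid with the law of $X_\Delta:=X(\Delta)$). $D=[a,b]$ is a fixed bounded interval bounded away from the origin. Small-time property (taken as given, recalled from the literature): for any bounded and continuous $f$ vanishing in a neighborhood of the origin, $\Delta^{-1}\mathsf{E}f(X_\Delta)=\int f(x)\psi^\star(x)\,dx+O(\Delta)$ as $\Delta\to0$. Sieve. $f_{K1},\dots,f_{KK}$ are bounded functions vanishing outside $D$, continuously differentiable on their respective supports, orthonormal in $L_2(D)$; $\mathcal{S}_K=\mathrm{span}\{f_{K1},\dots,f_{KK}\}$. For $\theta\in\mathbb{R}^K$, $\psi_\theta=\sum_{k=1}^K\theta_k f_{Kk}$. Define $$F_1(K)=\max_{k\le K}\Bigl\{\sup_{x\in D}|f_{Kk}(x)|+\int_D|f_{Kk}'(x)|\,dx\Bigr\},\quad F_2(K)=\max_{k\le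 K}\Bigl\{\sup_{x\in D}|f_{Kk}^2(x)|+2\int_D|f_{Kk}(x)f_{Kk}'(x)|\,dx\Bigr\}.$$ Projection and estimator. $\theta_{Kk}^\perp=\int_D f_{Kk}(x)\psi^\star(x)\,dx$, $\theta_K^\perp=(\theta_{K1}^\perp,\dots,\theta_{KK}^\perp)$, and $\psi_K^\perp=\psi_{\theta_K^\perp}$ is the $L_2(D)$ projection of $\psi^\star$ onto $\mathcal{S}_K$. $\hat\theta_{Kk}=t_n^{-1}\sum_{i=1}^n f_{Kk}(Y_i)$, $\hat\theta_K=(\hat\theta_{K1},\dots,\hat\theta_{KK})$. Gibbs posterior with fixed $K$. For $\theta\in\Theta_K\subseteq\mathbb{R}^K$, $R_{n,K}(\theta)=-2\langle\theta,\hat\theta_K\rangle+\|\theta\|^2$ (Euclidean inner product and norm). With learning rate $\omega>0$ (a fixed constant) and prior $\tilde\Pi_K$ on $\Theta_K$, for measurable $A\subseteq L_2(D)$, $$\Pi_n(A)=\frac{\int_{\{\theta\in\Theta_K:\psi_\theta\in A\}}e^{-\omega t_nR_{n,K}(\theta)}\,\tilde\Pi_K(d\theta)}{\int_{\Theta_K}e^{-\omega t_nR_{n,K}(\theta)}\,\tilde\Pi_K(d\theta)}.$$ *)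

(* Defs.v *)
From HB Require Import structures.
From mathcomp Require Import all_boot all_order all_algebra.
From mathcomp Require Import all_classical all_reals all_analysis.
Set Implicit Arguments.
Unset Strict Implicit.
Unset Printing Implicit Defensive.
Import Order.TTheory GRing.Theory Num.Theory.
Import numFieldNormedType.Exports.
Local Open Scope classical_set_scope.
Local Open Scope ring_scope.

Definition rV_display : measure_display -> measure_display.
Proof. exact. Qed.

Section rV_measurable.
Variables (R : realType) (n : nat).

Let coors : 'I_n -> 'rV[R]_n -> R := fun i v => v ord0 i.

Let rV_set0 : g_sigma_preimage coors set0.
Proof. exact: sigma_algebra0. Qed.

Let rV_setC A : g_sigma_preimage coors A -> g_sigma_preimage coors (~` A).
Proof. exact: sigma_algebraC. Qed.

Let rV_bigcup (F : _^nat) : (forall i, g_sigma_preimage coors (F i)) ->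
  g_sigma_preimage coors (\bigcup_i (F i)).
Proof. exact: sigma_algebra_bigcup. Qed.

(* The product (equivalently Borel) sigma-algebra on R^n. *)
HB.instance Definition _ := @isMeasurable.Build
  (rV_display default_measure_display)
  'rV[R]_n (g_sigma_preimage coors) rV_set0 rV_setC rV_bigcup.

End rV_measurable.

Lemma measurable_fun_rVP d (T : measurableType d) (R : realType) n
    (g : T -> 'rV[R]_n) :
  (forall i, measurable_fun setT (fun x => g x ord0 i)) ->
  measurable_fun setT g.
Proof.
move=> mg _ A mA; rewrite setTI; move: A mA.
have sS : sigma_algebra setT [set A : set 'rV[R]_n | measurable (g @^-1` A)].
  split => /=; first by rewrite preimage_set0.
    by move=> A mA; rewrite setTD preimage_setC; exact: measurableC.
  by move=> F mF; rewrite preimage_bigcup; exact: bigcupT_measurable.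
apply: smallest_sub => //.
move=> A; rewrite -bigcup_seq => -[i _ [B mB <-]] /=.
rewrite setTI -[X in measurable X]setTI.
exact: (mg i measurableT B mB).
Qed.

Lemma measurable_rV_coor (R : realType) n (i : 'I_n) :
  measurable_fun [set: 'rV[R]_n] (fun v => v ord0 i).
Proof.
move=> _ Y mY; apply: sub_sigma_algebra; rewrite -bigcup_seq/=.
exists i => /=; first by rewrite mem_index_enum.
by exists Y.
Qed.

Definition rV_cons (R : realType) n (xv : measurableTypeR R * 'rV[R]_n) :
    'rV[R]_n.+1 :=
  row_mx ((xv.1 : R)%:M : 'rV_1) xv.2.

Lemma rV_cons0 (R : realType) n (xv : measurableTypeR R * 'rV[R]_n) :
  rV_cons xv ord0 ord0 = xv.1.
Proof.
rewrite /rV_cons mxE; case: fintype.splitP => [j _|//].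
by rewrite mxE !ord1 eqxx mulr1n.
Qed.

Lemma rV_consS (R : realType) n (xv : measurableTypeR R * 'rV[R]_n) j :
  rV_cons xv ord0 (lift ord0 j) = xv.2 ord0 j.
Proof.
rewrite /rV_cons mxE; case: fintype.splitP => [[[]]//|k].
by rewrite /= /bump leq0n => -[jk]; congr (xv.2 _ _); exact/val_inj.
Qed.

Lemma measurable_rV_cons (R : realType) n :
  measurable_fun setT (@rV_cons R n).
Proof.
apply: measurable_fun_rVP => i.
rewrite (_ : (fun _ => _) = fun xv : measurableTypeR R * 'rV[R]_n =>
  match @fintype.split 1 n i with inl _ => xv.1 | inr j => xv.2 ord0 j end).
  case: fintype.split => j; first exact: measurable_fst.
  apply: (@measurableT_comp _ _ _ _ _ _ (fun v : 'rV[R]_n => v ord0 j)) => //.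
  exact: measurable_rV_coor.
apply/funext => xv; rewrite /rV_cons mxE.
by case: fintype.split => [j|//]; rewrite mxE !ord1 eqxx mulr1n.
Qed.

HB.instance Definition _ (R : realType) n :=
  isMeasurableFun.Build _ _ _ _ (@rV_cons R n) (@measurable_rV_cons R n).

Section lebesgue_rVS.
Variables (R : realType) (n : nat).
Variable m : {sigma_finite_measure set 'rV[R]_n -> \bar R}.

Definition lebesgue_rVS : set 'rV[R]_n.+1 -> \bar R :=
  pushforward (@lebesgue_measure R \x m)%E (@rV_cons R n).

Let pushforward_rV_cons : {measure set 'rV[R]_n.+1 -> \bar R} :=
  measure_function_pushforward__canonical__measure_function_Measure
    (@lebesgue_measure R \x m)%E (@measurable_rV_cons R n).

Let lebesgue_rVS0 : lebesgue_rVS set0 = 0%E.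
Proof. exact: (measure0 pushforward_rV_cons). Qed.

Let lebesgue_rVS_ge0 A : (0 <= lebesgue_rVS A)%E.
Proof. exact: (measure_ge0 pushforward_rV_cons). Qed.

Let lebesgue_rVS_sigma_additive : semi_sigma_additive lebesgue_rVS.
Proof. exact: (@measure_semi_sigma_additive _ _ _ pushforward_rV_cons). Qed.

HB.instance Definition _ := isMeasure.Build _ _ _ lebesgue_rVS
  lebesgue_rVS0 lebesgue_rVS_ge0 lebesgue_rVS_sigma_additive.

Let lebesgue_rVS_sigma_finite : sigma_finite setT lebesgue_rVS.
Proof.
have [F FT mF] : sigma_finite setT (@lebesgue_measure R \x m)%E.
  have /sigma_finiteP[F [TF ndF Foo]] := sigma_finiteT (@lebesgue_measure R).
  have /sigma_finiteP[G [TG ndG Goo]] := sigma_finiteT m.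
  exists (fun n => F n `*` G n).
    rewrite -setXTT TF TG predeqE => -[x y]; split.
      move=> [/= [i _ Fx] [j _ Gy]]; exists (maxn i j) => //; split.
        by move: x Fx; exact/subsetPset/ndF/leq_maxl.
      by move: y Gy; exact/subsetPset/ndG/leq_maxr.
    by move=> [i _ []/= ? ?]; split; exists i.
  move=> k; have [mFk Fk] := Foo k; have [mGk Gk] := Goo k.
  split; first exact: measurableX.
  by rewrite product_measure1E// lte_mul_pinfty// ge0_fin_numE.
pose u (v : 'rV[R]_n.+1) : measurableTypeR R * 'rV[R]_n :=
  (v ord0 ord0, \row_j v ord0 (lift ord0 j)).
have mu' : measurable_fun setT u.
  apply: measurable_fun_pair; first exact: measurable_rV_coor.
  apply: measurable_fun_rVP => i.
  under [X in measurable_fun _ X]eq_fun do rewrite mxE.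
  exact: measurable_rV_coor.
have uK xv : u (rV_cons xv) = xv.
  case: xv => x v; rewrite /u rV_cons0; congr pair.
  by apply/rowP => j; rewrite mxE rV_consS.
exists (fun i => u @^-1` F i).
  by rewrite -preimage_bigcup -FT preimage_setT.
move=> i; have [mFi Fi] := mF i; split.
  by rewrite -[X in measurable X]setTI; exact: mu'.
rewrite /lebesgue_rVS /pushforward.
rewrite (_ : _ @^-1` _ = F i)//; apply/seteqP; split => xv /=;
  by rewrite uK.
Qed.

HB.instance Definition _ := @Measure_isSigmaFinite.Build _ _ _
  lebesgue_rVS lebesgue_rVS_sigma_finite.

End lebesgue_rVS.

Fixpoint lebesgue_rV (R : realType) n :
    {sigma_finite_measure set 'rV[R]_n -> \bar R} :=
  match n with
  | 0 => [the {sigma_finite_measure set 'rV[R]_0 -> \bar R} of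
           \d_(0 : 'rV[R]_0)]
  | n.+1 => [the {sigma_finite_measure set 'rV[R]_n.+1 -> \bar R} of
              lebesgue_rVS (lebesgue_rV R n)]
  end.

Lemma lebesgue_rV_box (R : realType) n (B : 'I_n -> set R) :
  (forall i, measurable (B i)) ->
  lebesgue_rV R n [set v | forall i, B i (v ord0 i)] =
  (\prod_(i < n) lebesgue_measure (B i))%E.
Proof.
elim: n B => [|n IHn] B mB /=.
  by rewrite big_ord0 diracE mem_set// => -[].
rewrite /lebesgue_rVS /pushforward.
rewrite [X in (_ \x _)%E X](_ : _ = (B ord0 : set (measurableTypeR R)) `*`
    [set v : 'rV[R]_n | forall i : 'I_n, B (lift ord0 i) (v ord0 i)]);
  last first.
  apply/seteqP; split => xv /=.
    move=> h; split => [|i]; first by rewrite -(rV_cons0 xv); exact: h.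
    by rewrite -(rV_consS xv); exact: h.
  move=> [Bx Bv] i.
  by have [j ->|->] := unliftP ord0 i; rewrite ?rV_cons0 ?rV_consS.
rewrite product_measure1E; [|exact: mB|].
  rewrite big_ord_recl; congr (_ * _)%E.
  by apply: (IHn (fun i => B (lift ord0 i))) => i; exact: mB.
rewrite [X in measurable X](_ : _ = \bigcap_(i in setT)
   ((fun v : 'rV[R]_n => v ord0 i) @^-1` B (lift ord0 i))); last first.
  by apply/seteqP; split => v /= h i => [_|]; exact: h.
apply: fin_bigcap_measurable; first exact: finite_finset.
move=> i _; rewrite -[X in measurable X]setTI.
exact: measurable_rV_coor.
Qed.

(* Taking B i = setT for some i gives the product rule for every subfamily. *)
Definition mutually_independent d (T : measurableType d) (R : realType)
    (P : probability T R) m (Y : 'I_m -> T -> R) : Prop :=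
  forall B : 'I_m -> set R, (forall i, measurable (B i)) ->
  P (\bigcap_(i in [set: 'I_m]) Y i @^-1` B i) =
  (\prod_(i < m) P (Y i @^-1` B i))%E.

Definition cadlag (R : realType) (x : R -> R) : Prop :=
  forall t, 0 <= t -> x s @[s --> t^'+] --> x t /\
    (0 < t -> cvg (x s @[s --> t^'-])).

Definition levy_measure (R : realType) (Psi : {measure set R -> \bar R}) :
    Prop :=
  Psi [set 0] = 0%E /\ (\int[Psi]_x (Num.min (x ^+ 2) 1)%:E < +oo)%E.

(* Real and imaginary parts of the characteristic exponent
     i mu u - sigma^2 u^2 / 2 + int (e^(iux) - 1 - iux 1_(|x| <= 1)) Psi(dx). *)
Definition levy_exponent_Re (R : realType) (sigma : R)
    (Psi : {measure set R -> \bar R}) (u : R) : R :=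
  - (sigma ^+ 2 * u ^+ 2 / 2) + \int[Psi]_x (cos (u * x) - 1).

Definition levy_exponent_Im (R : realType) (mu : R)
    (Psi : {measure set R -> \bar R}) (u : R) : R :=
  mu * u + \int[Psi]_x (sin (u * x) - u * x * \1_`[-1, 1] x).

(* The process is indexed by R; only its values at times t >= 0 matter. *)
Record levy_process d (T : measurableType d) (R : realType)
    (P : probability T R) (X : R -> {RV P >-> R}) (mu sigma : R)
    (Psi : {measure set R -> \bar R}) : Prop := LevyProcess {
  levy_init : {ae P, forall w, X 0 w = 0} ;
  levy_independent_increments : forall m (t : nat -> R), 0 <= t 0%N ->
    {homo t : i j / (i <= j)%N >-> i <= j} ->
    mutually_independent P
      (fun (i : 'I_m) w => X (t i.+1) w - X (t i) w) ;
  levy_stationary_increments : forall (s h : R) (B : set R),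
    0 <= s -> 0 <= h -> measurable B ->
    P [set w | B (X (s + h) w - X s w)] = P [set w | B (X h w)] ;
  levy_stochastically_continuous : forall t eps : R, 0 <= t -> 0 < eps ->
    P [set w | eps < `|X s w - X t w|]
      @[s --> within [set s | 0 <= s] (nbhs t)] --> 0%E ;
  levy_cadlag : {ae P, forall w, cadlag (fun t => X t w)} ;
  levy_sigma_ge0 : 0 <= sigma ;
  levy_measureP : levy_measure Psi ;
  (* E exp(i u X_t) = exp(t (Re + i Im)), split into its two parts *)
  levy_khintchine_Re : forall t u : R, 0 <= t ->
    ('E_P[fun w => cos (u * X t w)])%E =
    (expR (t * levy_exponent_Re sigma Psi u) *
     cos (t * levy_exponent_Im mu Psi u))%:E ;
  levy_khintchine_Im : forall t u : R, 0 <= t ->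
    ('E_P[fun w => sin (u * X t w)])%E =
    (expR (t * levy_exponent_Re sigma Psi u) *
     sin (t * levy_exponent_Im mu Psi u))%:E }.

Definition levy_density (R : realType) (Psi : {measure set R -> \bar R})
    (psi : R -> R) : Prop :=
  [/\ measurable_fun setT psi, forall x, 0 <= psi x &
      forall A, measurable A ->
        Psi A = (\int[lebesgue_measure]_(x in A) (psi x)%:E)%E].

Definition small_time_property d (T : measurableType d) (R : realType)
    (P : probability T R) (X : R -> {RV P >-> R}) (psi : R -> R) : Prop :=
  forall g : R -> R, (exists B, forall x, `|g x| <= B) -> continuous g ->
    (\forall x \near (0 : R), g x = 0) ->
  (fun h : R => h^-1 * fine ('E_P[fun w => g (X h w)])%E
     - \int[lebesgue_measure]_x (g x * psi x)) =O_ (0^'+) (fun h : R => h).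

Section sieve.
Variable R : realType.
Implicit Types (g : R -> R) (S : set R).

Definition fsupport g : set R := [set x | g x != 0].

Definition diff_quotient g (x y : R) : R := (g y - g x) / (y - x).

Definition deriv_within S g (x : R) : R :=
  lim (diff_quotient g x y @[y --> within (S `\ x) (nbhs x)]).

Definition C1_on S g : Prop :=
  (forall x, S x -> cvg (diff_quotient g x y @[y --> within (S `\ x) (nbhs x)]))
  /\ {within S, continuous (deriv_within S g)}.

(* The derivative taken within the set [g != 0] and extended by 0. Working
   within this set, rather than its closure, allows functions such as the
   indicator of [c, d[. It agrees almost everywhere with the usual derivative
   when the closure of [g != 0] is an interval on which g is C1: the zeros of g
   at which g' is nonzero are isolated. *)
Definition support_deriv g (x : R) : R :=
  if g x != 0 then deriv_within (fsupport g) g x else 0.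

Variables (a b : R) (K : nat) (f : 'I_K -> R -> R).
Local Notation D := (`[a, b]%classic : set R).
Local Notation leb := (@lebesgue_measure R).

Record sieve : Prop := Sieve {
  sieve_measurable : forall k, measurable_fun setT (f k) ;
  sieve_bounded : forall k, exists B, forall x, `|f k x| <= B ;
  sieve_vanish : forall k x, ~ D x -> f k x = 0 ;
  sieve_C1 : forall k, C1_on (fsupport (f k)) (f k) ;
  sieve_orthonormal : forall j k,
    (\int[leb]_(x in D) (f j x * f k x)%:E = (j == k)%:R%:E)%E }.

Local Open Scope ereal_scope.

(* Extended-real valued: a non-integrable derivative yields +oo. *)
Definition sieve_F1 : \bar R := \big[maxe/-oo]_(k < K)
  (ereal_sup [set `|f k x|%:E | x in D]
   + \int[leb]_(x in D) `|support_deriv (f k) x|%:E).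

Definition sieve_F2 : \bar R := \big[maxe/-oo]_(k < K)
  (ereal_sup [set `|(f k x ^+ 2)%R|%:E | x in D]
   + 2%:E * \int[leb]_(x in D) `|(f k x * support_deriv (f k) x)%R|%:E).

Definition sampling_condition (Delta : nat -> R) : Prop :=
  exists C : R, \forall n \near \oo,
    maxe (sieve_F1 ^+ 2 * (n%:R * Delta n ^+ 3)%:E)
         (sieve_F2 * (Delta n)%:E) <= C%:E.

Local Close Scope ereal_scope.

Definition sieve_fun (theta : 'rV[R]_K) (x : R) : R :=
  \sum_(k < K) theta ord0 k * f k x.

Definition theta_perp (psi : R -> R) : 'rV[R]_K :=
  \row_k \int[leb]_(x in D) (f k x * psi x).

Definition L2norm (g : R -> R) : \bar R :=
  ('N[mrestr leb (measurable_itv `[a, b])]_2%:E[EFin \o g])%E.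

Definition in_sieve_span (g : R -> R) : Prop :=
  exists theta, {ae leb, forall x, D x -> g x = sieve_fun theta x}.

Definition dotrV (u v : 'rV[R]_K) : R := \sum_(k < K) u ord0 k * v ord0 k.

Definition risk (theta_hat theta : 'rV[R]_K) : R :=
  - 2 * dotrV theta theta_hat + dotrV theta theta.

(* The posterior mass of a set A of elements of L2(D), given by
   representatives; sieve functions always lie in L2(D). *)
Definition gibbs_posterior (omega t : R) (Theta : set 'rV[R]_K)
    (prior : probability 'rV[R]_K R) (theta_hat : 'rV[R]_K)
    (A : set (R -> R)) : R :=
  (\int[prior]_(theta in Theta `&` [set theta | A (sieve_fun theta)])
     expR (- (omega * t * risk theta_hat theta))) /
  (\int[prior]_(theta in Theta) expR (- (omega * t * risk theta_hat theta))).

Definition prior_density_near (prior : probability 'rV[R]_K R)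
    (theta0 : 'rV[R]_K) : Prop :=
  exists p : 'rV[R]_K -> R,
  [/\ measurable_fun setT p, forall theta, 0 <= p theta,
      forall A, measurable A ->
        prior A = (\int[lebesgue_rV R K]_(theta in A) (p theta)%:E)%E &
      exists2 c, 0 < c & \forall theta \near theta0,
        {for theta, continuous p} /\ c <= p theta].

End sieve.

Section estimator.
Variables (d : measure_display) (T : measurableType d) (R : realType).
Variables (P : probability T R) (X : R -> {RV P >-> R}).
Variables (K : nat) (f : 'I_K -> R -> R).

Definition increment (Delta : R) (i : nat) (w : T) : R :=
  X (i.+1%:R * Delta) w - X (i%:R * Delta) w.

Definition theta_hat (Delta : R) (n : nat) (w : T) : 'rV[R]_K :=
  \row_k ((n%:R * Delta)^-1 * \sum_(i < n) f k (increment Delta i w)).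

End estimator.

(* Main.v *)
Require Import Defs.
From HB Require Import structures.
From mathcomp Require Import all_boot all_order all_algebra.
From mathcomp Require Import all_classical all_reals all_analysis.
From mathcomp Require Import measurable_realfun ring lra.
Set Implicit Arguments.
Unset Strict Implicit.
Unset Printing Implicit Defensive.
Import Order.TTheory GRing.Theory Num.Theory.
Import numFieldNormedType.Exports.
Import HBNNSimple.
Local Open Scope classical_set_scope.
Local Open Scope ring_scope.

(* Bias. The functionals g |-> (E g(X_D) / D - int g psi) / D are pointwise
   bounded along D = Delta_n on the bounded continuous functions vanishing near
   the origin, hence uniformly bounded by the Banach-Steinhaus theorem. Their
   norms are total variations away from 0, so approximating f_k in L1 by
   continuous functions gives a bias O(Delta) for each bounded measurable f_k
   supported in D. Since F_1 > 0, n Delta^3 is bounded.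

   Concentration. Independence of the increments bounds the variance, so
   t E|theta_hat - theta_perp|^2 = O(1). The risk is |theta - theta_hat|^2 up to
   an additive constant. If |theta_hat - theta_perp| <= L t^(-1/2) and M >= 2L,
   then on {|theta - theta_perp| > M t^(-1/2)} the Gibbs weight is at most
   exp(- omega M^2 / 8) exp(- omega t |theta - theta_perp|^2 / 8), and the prior
   mass of a box of side s is of order s^K, so that numerator and denominator
   are both of order t^(-K/2) and the factor exp(- omega M^2 / 8) remains. *)

(** * Uniform boundedness and L1 approximation *)

(** The constant hidden in the $O(\Delta)$ of the small-time property depends on the test function,
    and that property speaks of continuous test functions only, whereas sieve functions may jump. No
    single continuous substitute serves a jump for all n: keeping the bias of order $\Delta_n$
    requires a substitute chosen afresh for each n, hence one constant valid for all continuous test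
    functions. Uniform boundedness supplies this constant, without making it explicit. For fixed n
    the functional is dominated, up to a factor depending on n, by integration against a finite
    measure: the law of $X_\Delta$ plus the part of $\Psi$ away from 0. Approximation in $L_1$ of
    that measure, to an accuracy depending on n, carries the uniform bound over to measurable
    functions. The same rate is used twice: for $f_k$ it bounds the bias, and for $f_k^2$ it gives
    $\mathsf{E} f_k^2(X_\Delta)=O(\Delta)$, which makes the variance of the estimator $O(1/t_n)$. *)

Lemma geometric_increments_limit (R : realType) (u : nat -> R) :
  (forall j, `|u j.+1 - u j| <= 3^-1 ^+ j) ->
  exists l, forall j, `|l - u j| <= 3 / 2 * 3^-1 ^+ j.
Proof.
(* [e j] is the tail sum of $3^{-i}$ over $i \ge j$, so the intervals of centre [u j] and radius
   [e j] are nested; the limit is the supremum of their left ends. *)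
move=> hu; pose e j : R := 3 / 2 * 3^-1 ^+ j.
have eS j : e j.+1 + 3^-1 ^+ j = e j by rewrite /e exprS; field.
have e0 j : 0 <= e j by rewrite /e mulr_ge0// ?exprn_ge0// ?invr_ge0//; lra.
have lo : {homo (fun j => u j - e j) : i j / (i <= j)%N >-> i <= j}.
  apply: homo_leq => // [|j]; first exact: le_trans.
  by have := eS j; have := hu j; rewrite ler_norml => /andP[]; lra.
have hi : {homo (fun j => u j + e j) : i j / (i <= j)%N >-> j <= i}.
  apply: homo_leq => // [y x z xy yz|j]; first exact: le_trans yz xy.
  by have := eS j; have := hu j; rewrite ler_norml => /andP[]; lra.
have lohi i j : u i - e i <= u j + e j.
  have := lo _ _ (leq_maxl i j); have := hi _ _ (leq_maxr i j).
  by have := e0 (maxn i j); lra.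
exists (sup (range (fun j => u j - e j))) => j.
have ub : ubound (range (fun j => u j - e j)) (u j + e j).
  by move=> _ [i _ <-]; exact: lohi.
rewrite ler_norml; apply/andP; split.
  suff : u j - e j <= sup (range (fun j => u j - e j)) by rewrite -/(e j); lra.
  by apply: ub_le_sup; [exists (u j + e j)|exists j].
suff : sup (range (fun j => u j - e j)) <= u j + e j by rewrite -/(e j); lra.
by apply: ge_sup => //; exists (u 0%N - e 0%N), 0%N.
Qed.

(* Sokal's elementary form of the Banach-Steinhaus theorem: if the norms of the
   functionals were unbounded, the series of [+-3^-j h_j], where [h_j] nearly
   norms the j-th functional and the signs avoid cancellation, would
   contradict pointwise boundedness. *)
Lemma uniform_boundedness (R : realType) (U : Type) (E : set (U -> R))
    (L : nat -> (U -> R) -> R) (N : nat -> R) :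
  E (fun=> 0) ->
  (forall g h c, E g -> E h -> E (fun x => g x + c * h x)) ->
  (forall g, (forall e, 0 < e -> exists2 h, E h & forall x, `|g x - h x| <= e)
    -> E g) ->
  (forall n g h c, E g -> E h ->
    L n (fun x => g x + c * h x) = L n g + c * L n h) ->
  (forall n g B, E g -> (forall x, `|g x| <= B) -> `|L n g| <= N n * B) ->
  (forall g, E g -> exists C, forall n, `|L n g| <= C) ->
  exists C, forall n g B, E g -> 0 < B -> (forall x, `|g x| <= B) ->
    `|L n g| <= C * B.
Proof.
move=> E0 ElC Elim Llin Lbnd Lpt.
have L0 n : L n (fun=> 0) = 0.
  have h := Llin n _ _ (-1) E0 E0.
  have e : (fun x : U => 0 + -1 * 0) = (fun=> 0 : R).
    by apply/funext => x; rewrite mulr0 addr0.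
  by rewrite e in h; rewrite h mulN1r subrr.
(* [S n], the supremum of [V n], is the norm of the n-th functional; the crude bound [N n] only
   ensures that it is finite. *)
pose V n := [set `|L n g| | g in [set g | E g /\ forall x, `|g x| <= 1]].
have V0 n : V n 0.
  exists (fun=> 0); first by split=> // x; rewrite normr0.
  by rewrite L0 normr0.
have hsV n : has_sup (V n).
  split; first by exists 0.
  by exists (N n) => _ [g [Eg g1] <-]; rewrite -[N n]mulr1; exact: Lbnd.
pose S n := sup (V n).
have S0 n : 0 <= S n by apply: ub_le_sup (V0 n); case: (hsV n).
have LS n g B : E g -> (forall x, `|g x| <= B) -> 0 < B -> `|L n g| <= S n * B.
  move=> Eg gB B0.
  (* Rescaling to the unit ball; the leading [0 +] fits the closure property, which is stated for
     combinations [g + c h]. *)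
  have EgB : E (fun x => 0 + B^-1 * g x) by exact: (ElC _ _ B^-1 E0 Eg).
  have : `|L n (fun x => 0 + B^-1 * g x)| <= S n.
    apply: ub_le_sup; first by case: (hsV n).
    exists (fun x => 0 + B^-1 * g x) => //; split=> // x.
    by rewrite add0r normrM gtr0_norm ?invr_gt0// mulrC ler_pdivrMr// mul1r.
  rewrite Llin//.
  by rewrite L0 add0r normrM gtr0_norm ?invr_gt0// mulrC ler_pdivrMr.
suff [C hC] : exists C, forall n, S n <= C.
  exists C => n g B Eg B0 gB; apply: (le_trans (LS n g B Eg gB B0)).
  by rewrite ler_wpM2r// ltW.
apply: contrapT => nbd.
(* Norms growing like $4^j$ against weights $3^{-j}$ leave a factor $(4/3)^j$, which diverges. *)
have /choice[nu hnu] : forall j : nat, exists n, 4 ^+ j < S n.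
  move=> j; apply: contrapT => h; apply: nbd; exists (4 ^+ j) => n.
  by rewrite leNgt; apply/negP => h'; apply: h; exists n.
have /choice[h hh] : forall j : nat, exists g, [/\ E g, forall x, `|g x| <= 1 &
    3 / 4 * S (nu j) < `|L (nu j) g|].
  move=> j; have Sj0 : 0 < S (nu j) by rewrite (le_lt_trans _ (hnu j)).
  have := @sup_adherent _ (V (nu j)) (S (nu j) / 4) _ (hsV (nu j)).
  rewrite divr_gt0// => /(_ isT)[_ [g [Eg g1] <-]]; rewrite -/(S _) => gt.
  by exists g; split=> //; lra.
pose step j (x : U -> R) : U -> R :=
  let p y := x y + 3^-1 ^+ j * h j y in let m y := x y + (- 3^-1 ^+ j) * h j y in
  if `|L (nu j) m| <= `|L (nu j) p| then p else m.
pose x := fix x j : U -> R := if j is i.+1 then step i (x i) else fun=> 0.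
have Ex j : E (x j).
  elim: j => [|j IH] //=; rewrite /step.
  by have [Eh _ _] := hh j; case: ifP => _; exact: ElC.
have xS j y : `|x j.+1 y - x j y| <= 3^-1 ^+ j.
  have [_ h1 _] := hh j.
  have e0 : 0 <= 3^-1 ^+ j :> R by rewrite exprn_ge0.
  rewrite /= /step; case: ifP => _; rewrite addrC addKr normrM ?normrN.
    by rewrite (ger0_norm e0) ler_piMr.
  by rewrite (ger0_norm e0) ler_piMr.
have Lx j : 3^-1 ^+ j * (3 / 4 * S (nu j)) <= `|L (nu j) (x j.+1)|.
  have [Eh _ hS] := hh j.
  have e0 : 0 <= 3^-1 ^+ j :> R by rewrite exprn_ge0.
  apply: (@le_trans _ _ (3^-1 ^+ j * `|L (nu j) (h j)|)).
    by rewrite ler_wpM2l// ltW.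
  pose u := L (nu j) (x j); pose v := 3^-1 ^+ j * L (nu j) (h j).
  have -> : 3^-1 ^+ j * `|L (nu j) (h j)| = `|v| by rewrite normrM ger0_norm.
  (* The larger of $|u+v|$ and $|u-v|$ is therefore at least $|v|$, which is what the choice of sign
     in [step] exploits. *)
  have v2 : 2 * `|v| <= `|u + v| + `|u - v|.
    rewrite -[2]normr_nat -normrM.
    by rewrite (_ : 2 * v = u + v - (u - v)); [exact: ler_normB|ring].
  rewrite /= /step !Llin// mulNr -/u -/v.
  by case: ifP => uv; rewrite Llin// ?mulNr -/u -/v;
    [|move/negbT: uv; rewrite -ltNge => uv]; lra.
have /choice[g hg] y : exists l, forall j, `|l - x j y| <= 3 / 2 * 3^-1 ^+ j.
  by apply: (@geometric_increments_limit _ (fun j => x j y)) => j; exact: xS.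
have Eg : E g.
  apply: Elim => e e0.
  have [j je] : exists j : nat, 3 / 2 * 3^-1 ^+ j <= e.
    pose j := (Num.truncn (2 / e)).+1.
    have je : 2 / e < j%:R by exact: truncnS_gt.
    have j3 : j%:R <= 3 ^+ j :> R by rewrite -natrX ler_nat ltnW// ltn_expl.
    exists j; rewrite exprVn ler_pdivrMr ?exprn_gt0//.
    apply: (@le_trans _ _ (e * (2 / e))); last first.
      by rewrite ler_wpM2l// ?(ltW e0)// (le_trans (ltW je)).
    by rewrite mulrCA divff ?gt_eqF// mulr1; lra.
  by exists (x j) => // y; exact: le_trans (hg y j) je.
have [C hC] := Lpt g Eg.
(* The terms after [x j.+1] amount to at most $3^{-j}/2$ in sup norm, so they cost $S\,3^{-j}/2$,
   while [Lx] gives $\frac34 S\,3^{-j}$. The difference $\frac14 S\,3^{-j}$ exceeds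
   $\frac14(4/3)^j$. *)
have bigj j : 4^-1 * (4 / 3) ^+ j <= C.
  have := hC (nu j); set d := fun y => g y + -1 * x j.+1 y.
  have Ed : E d by exact: ElC.
  have dB : `|L (nu j) d| <= S (nu j) * (2^-1 * 3^-1 ^+ j).
    apply: LS => // [y].
    rewrite /d mulN1r; apply: (le_trans (hg y j.+1)).
    by rewrite exprS mulrA ler_wpM2r ?exprn_ge0//; lra.
  have LgE : L (nu j) d = L (nu j) g - L (nu j) (x j.+1).
    by rewrite Llin// mulN1r.
  have tri : `|L (nu j) (x j.+1)| <= `|L (nu j) g| + `|L (nu j) d|.
    rewrite LgE -[X in `|X| <= _](subKr (L (nu j) g)).
    exact: ler_normB.
  have := Lx j; rewrite expr_div_n -exprVn.
  have : 3^-1 ^+ j * 4 ^+ j <= 3^-1 ^+ j * S (nu j) :> R.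
    by rewrite ler_wpM2l// ?exprn_ge0// ltW.
  by rewrite [4 ^+ j * _]mulrC; lra.
have bern j : 1 + j%:R / 3 <= (4 / 3) ^+ j :> R.
  elim: j => [|j IH]; first by rewrite mul0r addr0 expr0.
  have j0 : 0 <= j%:R :> R by [].
  rewrite exprS -natr1; apply: (@le_trans _ _ (4 / 3 * (1 + j%:R / 3))).
    lra.
  by rewrite ler_wpM2l//; lra.
have := truncnS_gt (12 * C); set j := (Num.truncn _).+1.
by have := bern j; have := bigj j; lra.
Qed.

Section L1_approximation.
Variables (R : realType) (m : {measure set R -> \bar R}).
Hypothesis mfin : (m setT < +oo)%E.
Implicit Types f g h : R -> R.

(** The bound on the approximant is not tied to that of [f], which keeps the closure properties
    simple; a truncation restores it when the approximation is used. *)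
Definition L1approx f := measurable_fun setT f /\ forall e, 0 < e ->
  exists g, [/\ continuous g, (exists B, forall x, `|g x| <= B) &
    (\int[m]_x `|f x - g x|%:E <= e%:E)%E].

Lemma integral_normD_le f g h :
  measurable_fun setT f -> measurable_fun setT g -> measurable_fun setT h ->
  (forall x, `|f x| <= `|g x| + `|h x|) ->
  (\int[m]_x `|f x|%:E <= \int[m]_x `|g x|%:E + \int[m]_x `|h x|%:E)%E.
Proof.
have mn (k : R -> R) : measurable_fun setT k -> measurable_fun setT (fun x => `|k x|%:E).
  by move=> mk; apply/measurable_EFinP; exact: measurableT_comp.
move=> mf mg mh fgh; rewrite -ge0_integralD//; [|exact: mn..].
apply: ge0_le_integral => //; first exact: mn.
  by apply: emeasurable_funD; exact: mn.
by move=> x _; rewrite -EFinD lee_fin.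
Qed.

Lemma L1approx_continuous f B : continuous f -> (forall x, `|f x| <= B) ->
  L1approx f.
Proof.
move=> cf fB; split; first exact: continuous_measurable_fun.
move=> e e0; exists f; split=> //; first by exists B.
under eq_integral do rewrite subrr normr0.
by rewrite integral0 lee_fin ltW.
Qed.

Lemma L1approxD f g : L1approx f -> L1approx g -> L1approx (fun x => f x + g x).
Proof.
move=> [mf Hf] [mg Hg]; split; first exact: measurable_funD.
move=> e e0; have e20 : 0 < e / 2 by rewrite divr_gt0.
have [f' [cf' [Bf bf] If]] := Hf _ e20; have [g' [cg' [Bg bg] Ig]] := Hg _ e20.
exists (fun x => f' x + g' x); split.
- by move=> x; apply: cvgD; [exact: cf'|exact: cg'].
- by exists (Bf + Bg) => x; rewrite (le_trans (ler_normD _ _))// lerD.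
- have mf' := continuous_measurable_fun cf'.
  have mg' := continuous_measurable_fun cg'.
  apply: le_trans (_ : _ <= (e / 2)%:E + (e / 2)%:E)%E _; last first.
    by rewrite -EFinD lee_fin -splitr.
  apply: le_trans (leeD If Ig); apply: integral_normD_le.
  + by apply: measurable_funB; exact: measurable_funD.
  + exact: measurable_funB.
  + exact: measurable_funB.
  + by move=> x; rewrite opprD addrACA ler_normD.
Qed.

Lemma L1approx_sum k (F : 'I_k -> R -> R) : (forall i, L1approx (F i)) ->
  L1approx (fun x => \sum_(i < k) F i x).
Proof.
elim: k F => [|k IH] F HF.
  under eq_fun do rewrite big_ord0.
  by apply: (@L1approx_continuous _ 0) => x; [exact: cvg_cst|rewrite normr0].
under eq_fun do rewrite big_ord_recr/=.
by apply: L1approxD => //; apply: IH.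
Qed.

Lemma L1approx_max f g : L1approx f -> L1approx g ->
  L1approx (fun x => Num.max (f x) (g x)).
Proof.
move=> [mf Hf] [mg Hg]; split; first exact: measurable_maxr.
move=> e e0; have e20 : 0 < e / 2 by rewrite divr_gt0.
have [f' [cf' [Bf bf] If]] := Hf _ e20; have [g' [cg' [Bg bg] Ig]] := Hg _ e20.
exists (fun x => Num.max (f' x) (g' x)); split.
- by move=> x; apply: continuous_max; [exact: cf'|exact: cg'].
- exists (Num.max Bf Bg) => x; rewrite le_max.
  by case: (lerP (f' x) (g' x)) => _; rewrite ?bf ?bg ?orbT.
- have mf' := continuous_measurable_fun cf'.
  have mg' := continuous_measurable_fun cg'.
  apply: le_trans (_ : _ <= (e / 2)%:E + (e / 2)%:E)%E _; last first.
    by rewrite -EFinD lee_fin -splitr.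
  apply: le_trans (leeD If Ig); apply: integral_normD_le.
  + by apply: measurable_funB; exact: measurable_maxr.
  + exact: measurable_funB.
  + exact: measurable_funB.
  + move=> x; case: (lerP (f x) (g x)) => fg; case: (lerP (f' x) (g' x)) => fg';
    rewrite !ler_norml; case: (lerP 0 (f x - f' x)) => h1;
    case: (lerP 0 (g x - g' x)) => h2; rewrite ?(ger0_norm h1) ?(ltr0_norm h1)
      ?(ger0_norm h2) ?(ltr0_norm h2); apply/andP; split; lra.
Qed.

Lemma L1approxZ c f : L1approx f -> L1approx (fun x => c * f x).
Proof.
move=> [mf Hf]; split; first exact: measurable_funM.
move=> e e0; have c0 : 0 < `|c| + 1 by rewrite ltr_wpDl.
have [|g [cg [B bg] Ig]] := Hf (e / (`|c| + 1)); first by rewrite divr_gt0.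
have mg := continuous_measurable_fun cg.
exists (fun x => c * g x); split.
- by move=> x; apply: cvgM; [exact: cvg_cst|exact: cg].
- by exists (`|c| * B) => x; rewrite normrM ler_wpM2l.
- under eq_integral do rewrite -mulrBr normrM EFinM.
  rewrite ge0_integralZl_EFin//; last first.
    by apply/measurable_EFinP; apply: measurableT_comp => //; exact: measurable_funB.
  apply: (le_trans (lee_wpmul2l _ Ig)) => //; rewrite -EFinM lee_fin.
  by rewrite mulrCA ger_pMr// ler_pdivrMr// mul1r lerDl.
Qed.

(** Dominated convergence applies with the constant [B] as envelope, since [m] is finite; a triangle
    inequality then passes from [F n] to its continuous approximant. *)
Lemma L1approx_lim (F : nat -> R -> R) f B : (forall n, L1approx (F n)) ->
  (forall n x, `|F n x| <= B) -> (forall x, F n x @[n --> \oo] --> f x) ->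
  L1approx f.
Proof.
move=> HF FB Ff.
have mf : measurable_fun setT f.
  exact: (@measurable_fun_cvg _ _ _ setT F f (fun n => (HF n).1)
    (fun x _ => Ff x)).
split=> // e e0; have e20 : 0 < e / 2 by rewrite divr_gt0.
have [] := @dominated_convergence _ _ R m setT measurableT
  (fun n x => (F n x)%:E) (EFin \o f) (cst B%:E).
- by move=> n; apply/measurable_EFinP; case: (HF n).
- exact/measurable_EFinP.
- by apply/aeW => x _; apply: cvg_EFin; [exact: nearW|exact: Ff].
- apply: measurable_bounded_integrable => //; exact: bounded_cst.
- by apply/aeW => x n _; rewrite lee_fin.
move=> _ /fine_cvgP[fin /cvgr0Pnorm_lt /(_ _ e20) cv] _.
near \oo => n.
have In : (\int[m]_x `|F n x - f x|%:E <= (e / 2)%:E)%E.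
  have -> : (\int[m]_x `|F n x - f x|%:E = \int[m]_x `|(F n x)%:E - (EFin \o f) x|)%E.
    by apply: eq_integral.
  rewrite -[leLHS]fineK; last by near: n; exact: fin.
  rewrite lee_fin; apply: (le_trans (ler_norm _)); apply: ltW.
  by near: n; exact: cv.
have [mFn /(_ _ e20)[g [cg Bg Ig]]] := HF n.
exists g; split=> //.
apply: le_trans (_ : _ <= (e / 2)%:E + (e / 2)%:E)%E _; last first.
  by rewrite -EFinD lee_fin -splitr.
have mg := continuous_measurable_fun cg.
apply: le_trans (leeD In Ig); apply: integral_normD_le; try exact: measurable_funB.
by move=> x; rewrite [`|F n x - f x|]distrC; exact: ler_distD.
Unshelve. all: by end_near. Qed.

Lemma L1approx_ray (a : R) : L1approx (\1_`[a, +oo[%classic : R -> R).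
Proof.
(* Piecewise linear: equal to 1 on $[a,\infty)$ and, for $n \ge 1$, descending to 0 on
   $[a-1/n,a]$. *)
pose F (n : nat) (x : R) : R := Num.max 0 (1 - Num.max 0 (n%:R * (a - x))).
have F1 n x : `|F n x| <= 1.
  rewrite ger0_norm ?le_max ?lexx// /F ge_max ler01/= gerBl.
  by rewrite le_max lexx.
apply: (@L1approx_lim F _ 1) => //.
  move=> n; apply: (@L1approx_continuous _ 1) => // x.
  apply: (@continuous_max R R (cst 0) (fun x => 1 - Num.max 0 (n%:R * (a - x)))).
    exact: cvg_cst.
  apply: cvgB; first exact: cvg_cst.
  apply: (@continuous_max R R (cst 0) (fun x => n%:R * (a - x))).
    exact: cvg_cst.
  by apply: cvgM; [exact: cvg_cst|apply: cvgB; [exact: cvg_cst|exact: cvg_id]].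
move=> x; rewrite indicE; have [ax|xa] := leP a x.
  rewrite mem_set; last by rewrite /= in_itv/= ax.
  have -> : (fun n => F n x) = cst 1.
    apply/funext => n; rewrite /F.
    have -> : Num.max 0 (n%:R * (a - x)) = 0.
      by apply/max_idPl; rewrite mulr_ge0_le0// subr_le0.
    by rewrite subr0; apply/max_idPr.
  exact: cvg_cst.
rewrite memNset; last by rewrite /= in_itv/= andbT; apply/negP; rewrite -ltNge.
apply: cvg_near_cst; near=> n.
rewrite /F (max_idPl _)// subr_le0 le_max; apply/orP; right.
rewrite -ler_pdivrMr ?subr_gt0//; near: n; exact: nbhs_infty_ger.
Unshelve. all: by end_near. Qed.

(** The sets with an approximable indicator form a sigma-algebra containing the generating rays:
    complements are affine, finite unions are maxima of indicators, and countable unions are bounded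
    pointwise limits of finite ones. *)
Lemma L1approx_indic (A : set R) : measurable A -> L1approx (\1_A : R -> R).
Proof.
rewrite [X in X A]RGenCInfty.measurableE.
move: A; apply: smallest_sub; last by move=> _ [a ->]; exact: L1approx_ray.
have L0 : L1approx (\1_set0 : R -> R).
  rewrite indic0; apply: (@L1approx_continuous _ 0) => x; first exact: cvg_cst.
  by rewrite normr0.
split => //= [A LA|F LF].
  rewrite setTD (_ : \1_(~` A) = fun x : R => (cst 1 x : R) + -1 * \1_A x).
    apply: L1approxD; last exact: L1approxZ.
    apply: (@L1approx_continuous _ 1) => x; first exact: cvg_cst.
    by rewrite normr1.
  apply/funext => x; rewrite !indicE in_setC mulN1r /=.
  by case: (x \in A); rewrite ?subrr ?subr0.
pose U n : set R := \big[setU/set0]_(i < n) F i.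
have LU n : L1approx (\1_(U n) : R -> R).
  elim: n => [|n IH]; first by rewrite /U big_ord0.
  rewrite /U big_ord_recr/= -/(U n).
  rewrite (_ : \1_(U n `|` F n) = fun x : R => Num.max (\1_(U n) x : R) (\1_(F n) x)).
    exact: L1approx_max.
  apply/funext => x; rewrite !indicE in_setU.
  case: (x \in U n); case: (x \in F n) => /=; rewrite ?maxxx//.
    by rewrite (max_idPl _).
  by rewrite (max_idPr _).
apply: (@L1approx_lim (fun n => \1_(U n)) _ 1) => //.
  by move=> n x; rewrite indicE; case: (x \in U n) => /=; rewrite ?normr1 ?normr0.
move=> x; rewrite indicE; case: (boolP (x \in _)) => [|].
  rewrite inE => -[i _ Fix]; apply: cvg_near_cst; near=> n.
  rewrite indicE mem_set// /U -bigcup_mkord; exists i => //=.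
  by near: n; exact: nbhs_infty_gt.
rewrite notin_setE => nF; apply: cvg_near_cst; apply: nearW => n.
rewrite indicE memNset// /U -bigcup_mkord => -[i _ Fix]; apply: nF.
by exists i.
Unshelve. all: by end_near. Qed.

(** Adding [B] makes the function nonnegative with values at most [2 * B], hence a bounded pointwise
    limit of simple functions. *)
Lemma L1approx_bounded f B : measurable_fun setT f -> (forall x, `|f x| <= B) ->
  L1approx f.
Proof.
move=> mf fB.
have Lcst (c : R) : L1approx (cst c).
  by apply: (@L1approx_continuous _ `|c|) => // x; exact: cvg_cst.
pose h x := (f x + B)%:E.
have mh : measurable_fun setT h.
  by apply/measurable_EFinP; exact: measurable_funD.
have h0 x : setT x -> (0 <= h x)%E.
  by move=> _; rewrite lee_fin; have := fB x; rewrite ler_norml => /andP[]; lra.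
pose s n : {nnsfun R >-> R} := nnsfun_approx measurableT mh n.
have cvs x : s n x @[n --> \oo] --> f x + B.
  exact: (fine_cvg (cvg_nnsfun_approx measurableT mh h0 (I : setT x))).
have s_le n x : s n x <= f x + B.
  have := cvs x; move/cvg_lim => <- //.
  apply: (@nondecreasing_cvgn_le _ (fun n => s n x)).
    by move=> i j ij; exact/lefP/nd_nnsfun_approx.
  by apply/cvg_ex; exists (f x + B); exact: cvs.
suff Lh : L1approx (fun x => f x + B).
  rewrite (_ : f = fun x => (f x + B) + cst (- B) x); last first.
    by apply/funext => x /=; rewrite addrK.
  exact: L1approxD.
apply: (@L1approx_lim (fun n => s n) _ (2 * B)) => //; last first.
  move=> n x; rewrite ger0_norm//; apply: (le_trans (s_le n x)).
  by have := fB x; rewrite ler_norml => /andP[]; lra.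
move=> n; have /= /funext -> := @fimfunEord R R (s n).
apply: L1approx_sum => i; apply: L1approxZ; apply: L1approx_indic.
exact: measurable_funPTI.
Qed.

End L1_approximation.

(** * Small-time rate for bounded functions *)

(* The map [phi] is the identity in all uses: it mediates between the two
   measurable structures carried by the reals. *)
Lemma integral_density d d' (T : measurableType d) (T' : measurableType d')
    (R : realType) (m : {measure set T -> \bar R})
    (m' : {measure set T' -> \bar R}) (phi : T -> T') (p : T -> R) (h : T' -> R) :
  measurable_fun setT phi ->
  measurable_fun setT p -> (forall x, 0 <= p x) ->
  measurable_fun setT h -> (forall x, 0 <= h x) ->
  (forall A, measurable A -> m' A = \int[m]_(x in phi @^-1` A) (p x)%:E)%E ->
  (\int[m']_x (h x)%:E = \int[m]_x (h (phi x) * p x)%:E)%E.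
Proof.
move=> mphi mp p0 mh h0 m'E.
have mhE : measurable_fun setT (EFin \o h) by exact/measurable_EFinP.
pose s n : {nnsfun T' >-> R} := nnsfun_approx measurableT mhE n.
have h0E x : setT x -> (0 <= (EFin \o h) x)%E by rewrite lee_fin.
have cvs x : (s n x)%:E @[n --> \oo] --> (h x)%:E.
  exact: (cvg_nnsfun_approx measurableT mhE h0E (I : setT x)).
have nds x i j : (i <= j)%N -> s i x <= s j x.
  by move=> ij; exact/lefP/nd_nnsfun_approx.
have hm' : (\int[m']_x (s n x)%:E @[n --> \oo] --> \int[m']_x (h x)%:E)%E.
  have -> : (\int[m']_x (h x)%:E = \int[m']_x limn (fun n => (s n x)%:E))%E.
    by apply: eq_integral => x _; apply/esym/cvg_lim => //; exact: cvs.
  apply: cvg_monotone_convergence => //.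
  - by move=> n; exact/measurable_EFinP.
  - by move=> n x _; rewrite lee_fin.
  - by move=> x _ i j ij; rewrite lee_fin nds.
have hm : (\int[m]_x (s n (phi x) * p x)%:E @[n --> \oo] --> \int[m]_x (h (phi x) * p x)%:E)%E.
  have -> : (\int[m]_x (h (phi x) * p x)%:E
      = \int[m]_x limn (fun n => (s n (phi x) * p x)%:E))%E.
    apply: eq_integral => x _; apply/esym/cvg_lim => //.
    rewrite EFinM; under eq_fun do rewrite EFinM.
    by apply: cvgeZr => //; exact: cvs.
  apply: cvg_monotone_convergence => //.
  - by move=> n; apply/measurable_EFinP; apply: measurable_funM => //;
    exact: measurableT_comp.
  - by move=> n x _; rewrite lee_fin mulr_ge0.
  - by move=> x _ i j ij; rewrite lee_fin ler_wpM2r// nds.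
(* Monotone convergence on both sides leaves the identity for simple functions, where it is the
   hypothesis on [m'] applied to level sets. *)
suff e n : (\int[m']_x (s n x)%:E = \int[m]_x (s n (phi x) * p x)%:E)%E.
  by move: hm'; under eq_fun do rewrite e; move/cvg_unique; apply.
have /= /funext sE := @fimfunEord T' R (s n).
have sA (c : R) : measurable (s n @^-1` [set c]) by exact: measurable_funPTI.
(* An entry of the list is a value of [s n], hence nonnegative; beyond its end [nth] returns the
   default 0. *)
have c0 i : 0 <= (finmap.enum_fset (fset_set (range (s n))))`_i.
  have [/(mem_nth 0)|/(nth_default 0) ->//] :=
    ltnP i (size (finmap.enum_fset (fset_set (range (s n))))).
  by rewrite in_fset_set// inE => -[x _ <-].
have mcA (c c' : R) : measurable_fun setT (fun x : T' => c * \1_(s n @^-1` [set c']) x).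
  by apply: measurable_funM; [exact: measurable_cst|exact: measurable_indic].
rewrite sE; under eq_integral do rewrite -sumEFin.
under [RHS]eq_integral do rewrite mulr_suml -sumEFin.
rewrite ge0_integral_sum//; last 2 first.
- by move=> i; apply/measurable_EFinP; exact: mcA.
- by move=> i x _; rewrite lee_fin mulr_ge0.
rewrite ge0_integral_sum//; last 2 first.
- by move=> i; apply/measurable_EFinP; apply: measurable_funM => //;
  exact: (measurableT_comp (mcA _ _)).
- by move=> i x _; rewrite lee_fin !mulr_ge0.
apply: eq_bigr => i _; set c := _`_i.
under eq_integral do rewrite EFinM.
under [RHS]eq_integral do rewrite -mulrA EFinM.
have mA : measurable_fun setT (\1_(s n @^-1` [set c]) : T' -> R).
  exact: measurable_indic.
rewrite ge0_integralZl_EFin; [|by []|by move=> x _; rewrite lee_fin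
  |exact/measurable_EFinP|exact: c0].
rewrite ge0_integralZl_EFin; [|by []|by move=> x _; rewrite lee_fin mulr_ge0
  |by apply/measurable_EFinP; apply: measurable_funM => //; exact: measurableT_comp
  |exact: c0].
rewrite integral_indic// setIT m'E// integral_mkcond; congr (_ * _)%E.
apply: eq_integral => x _; rewrite patchE indicE.
case: ifPn; rewrite ?inE ?notin_setE => ?; first by rewrite mem_set ?mul1r.
by rewrite memNset ?mul0r.
Qed.

(** The restriction of [m] to [D] has density [\1_D] with respect to [m]. *)
Lemma ge0_integral_mrestr d (T : measurableType d) (R : realType)
    (m : {measure set T -> \bar R}) (D : set T) (mD : measurable D) (h : T -> R) :
  measurable_fun setT h -> (forall x, 0 <= h x) ->
  (\int[mrestr m mD]_x (h x)%:E = \int[m]_(x in D) (h x)%:E)%E.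
Proof.
move=> mh h0; rewrite (@integral_density _ _ _ _ _ m _ id (\1_D))//.
- rewrite [RHS]integral_mkcond; apply: eq_integral => x _.
  by rewrite patchE indicE; case: ifPn => _; rewrite ?mulr1 ?mulr0.
- by move=> A mA; rewrite integral_indic// setIC.
Qed.

(** Markov's inequality: with $c=\min(e^2,1)$, the function $c\,1_{|x|\ge e}$ lies below
    $\min(x^2,1)$. *)
Lemma levy_measure_tail_fin (R : realType) (Psi : {measure set R -> \bar R}) (e : R) :
  0 < e -> levy_measure Psi -> (Psi [set x | (e <= `|x|)%R] < +oo)%E.
Proof.
move=> e0 [_ fin]; set A := [set x | _].
have mA : measurable A.
  rewrite (_ : A = setT `&` (fun x : R => `|x|) @^-1` `[e, +oo[); last first.
    by apply/seteqP; split => x /=; rewrite in_itv/= andbT// => -[].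
  by apply: measurableT_comp.
pose c := Num.min (e ^+ 2) 1; have c0 : 0 < c by rewrite lt_min ltr01 exprn_gt0.
rewrite -(@lte_pmul2l _ c%:E) ?lte_fin//.
rewrite [X in (_ < X)%E]mulry gtr0_sg// mul1e; apply: le_lt_trans fin.
rewrite -[X in Psi X]setIT -integral_indic// -ge0_integralZl_EFin;
  [|by []|by move=> x _; rewrite lee_fin
  |by apply/measurable_EFinP; exact: measurable_indic|exact: ltW].
apply: ge0_le_integral => //.
- by move=> x _; rewrite lee_fin mulr_ge0// ltW.
- by apply/measurable_EFinP/measurable_funM => //; exact: measurable_indic.
- by apply/measurable_EFinP; apply: measurable_minr.
- move=> x _; rewrite lee_fin indicE; case: (boolP (x \in A)) => [|_]/=.
    rewrite inE /A /= mulr1 => ex; rewrite /c le_min; apply/andP; split.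
      rewrite ge_min; apply/orP; left.
      by rewrite -(real_normK (num_real x)) lerXn2r// nnegrE ltW.
    by rewrite ge_min lexx orbT.
  by rewrite mulr0 le_min ler01 sqr_ge0.
Qed.

Lemma bounded_integrable d (T : measurableType d) (R : realType)
    (m : {measure set T -> \bar R}) (f : T -> R) (B : R) :
  (m setT < +oo)%E -> measurable_fun setT f -> (forall x, `|f x| <= B) ->
  m.-integrable setT (EFin \o f).
Proof.
move=> mfin mf fB; apply: measurable_bounded_integrable => //.
exists B; split; first exact: num_real.
by move=> x Bx y _; apply: le_trans (fB y) (ltW Bx).
Qed.

Lemma measurable_id_lebesgue (R : realType) :
  measurable_fun [set: measurableTypeR R] (id : measurableTypeR R -> R).
Proof. by move=> _ A mA; rewrite setTI preimage_id. Qed.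

Lemma integral_levy_density (R : realType) (Psi : {measure set R -> \bar R})
    (psi h : R -> R) : levy_density Psi psi ->
  measurable_fun setT h -> (forall x, 0 <= h x) ->
  (\int[Psi]_x (h x)%:E = \int[lebesgue_measure]_x (h x * psi x)%:E)%E.
Proof.
move=> [mp p0 pE] mh h0.
exact: (integral_density (measurable_id_lebesgue (R := R)) mp p0 mh h0 pE).
Qed.

Section small_time_bound.
Variables (d : measure_display) (T : measurableType d) (R : realType).
Variables (P : probability T R) (X : R -> {RV P >-> R}).
Variables (Psi : {measure set R -> \bar R}) (psi : R -> R) (Delta : nat -> R).
Hypothesis HPsi : levy_measure Psi.
Hypothesis Hpsi : levy_density Psi psi.
Hypothesis Hsmall : small_time_property X psi.
Hypothesis Delta_gt0 : forall n, 0 < Delta n.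
Hypothesis Delta0 : Delta n @[n --> \oo] --> 0.
Variables (delta : R).
Hypothesis delta_gt0 : 0 < delta.

Let bounded_away (f : R -> R) :=
  [/\ measurable_fun setT f, exists B, forall x, `|f x| <= B &
      forall x, `|x| < delta -> f x = 0].

(** The small-time error is divided by $\Delta_n$ once more, so that a bound on [L n f] uniform in n
    is an error of order $\Delta_n$. *)
Let L n (f : R -> R) : R := (Delta n)^-1 *
  ((Delta n)^-1 * \int[P]_w f (X (Delta n) w)
   - \int[lebesgue_measure]_x (f x * psi x)).

Let tail : set R := [set x | (delta <= `|x|)%R].

Let mtail : measurable tail.
Proof.
rewrite (_ : tail = setT `&` (fun x : R => `|x|) @^-1` `[delta, +oo[); last first.
  by apply/seteqP; split => x /=; rewrite /tail /= in_itv/= andbT// => -[].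
by apply: measurableT_comp.
Qed.

(** A finite measure dominating both integrals in [L n] for functions that vanish on [|x| < delta];
    the restriction to [tail] makes it finite although $\Psi$ may have infinite mass near 0. *)
Let m n := measure_add (distribution P (X (Delta n))) (mrestr Psi mtail).

Let m_fin n : (m n setT < +oo)%E.
Proof.
rewrite /m measure_addE; apply: lte_add_pinfty.
  have Q1 : distribution P (X (Delta n)) setT = 1%E by exact: probability_setT.
  exact: (eq_ind_r (fun z => (z < +oo)%E) (ltry 1) Q1).
have Q2 : mrestr Psi mtail setT = Psi tail by rewrite /mrestr setTI.
exact: (eq_ind_r (fun z => (z < +oo)%E) (levy_measure_tail_fin delta_gt0 HPsi) Q2).
Qed.

Let mE n (h : R -> R) : measurable_fun setT h -> (forall x, 0 <= h x) ->
  (forall x, `|x| < delta -> h x = 0) ->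
  (\int[m n]_x (h x)%:E = \int[P]_w (h (X (Delta n) w))%:E
     + \int[lebesgue_measure]_x (h x * psi x)%:E)%E.
Proof.
move=> mh h0 hd; have [mp p0 pE] := Hpsi.
have mhE : measurable_fun setT (EFin \o h) by exact/measurable_EFinP.
rewrite ge0_integral_measure_add//; last by move=> x _; rewrite lee_fin.
rewrite ge0_integral_distribution//.
rewrite ge0_integral_mrestr// -(integral_levy_density Hpsi)//.
congr (_ + _)%E; rewrite integral_mkcond; apply: eq_integral => x _.
rewrite patchE; case: ifPn => //; rewrite notin_setE /tail/= => /negP.
by rewrite -ltNge => /hd ->.
Qed.

Let intP n (h : R -> R) : bounded_away h ->
  P.-integrable setT (EFin \o (fun w => h (X (Delta n) w))).
Proof.
move=> [mh [B hB] _]; apply: (@bounded_integrable _ _ _ _ _ B) => //;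
  last exact: measurableT_comp.
exact: (le_lt_trans (probability_le1 P measurableT) (ltry 1)).
Qed.

Let bounded_awayN (h : R -> R) : bounded_away h -> bounded_away (fun x => `|h x|).
Proof.
move=> [mh [B hB] hd]; split; first exact: measurableT_comp.
  by exists B => x; rewrite normr_id.
by move=> x /hd ->; rewrite normr0.
Qed.

Let m_lt_pinfty n (h : R -> R) : bounded_away h ->
  (\int[m n]_x `|h x|%:E < +oo)%E.
Proof.
move=> [mh [B hB] _].
have /integrableP[_] := bounded_integrable (m_fin n) mh hB.
by under eq_integral do rewrite /=.
Qed.

Let intpsi (h : R -> R) : bounded_away h ->
  lebesgue_measure.-integrable setT (EFin \o (fun x => h x * psi x)).
Proof.
move=> hh; have [mp p0 pE] := Hpsi; have [mh _ hd] := hh.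
apply/integrableP; split; first exact/measurable_EFinP/measurable_funM.
(* Any index would do: the $\Psi$ part of [m n] does not depend on n. *)
apply: le_lt_trans (m_lt_pinfty 0 hh).
have [mn _ nd] := bounded_awayN hh.
rewrite mE//.
under eq_integral do rewrite /= normrM (ger0_norm (p0 _)).
by rewrite leeDr// integral_ge0.
Qed.

Let bounded_awayD (g h : R -> R) (c : R) : bounded_away g -> bounded_away h ->
  bounded_away (fun x => g x + c * h x).
Proof.
move=> [mg [Bg gB] gd] [mh [Bh hB] hd]; split.
- by apply: measurable_funD => //; exact: measurable_funM.
- exists (Bg + `|c| * Bh) => x; rewrite (le_trans (ler_normD _ _))// lerD//.
  by rewrite normrM ler_wpM2l.
- by move=> x xd; rewrite gd// hd// mulr0 addr0.
Qed.

Let Llin n (g h : R -> R) (c : R) : bounded_away g -> bounded_away h ->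
  L n (fun x => g x + c * h x) = L n g + c * L n h.
Proof.
move=> hg hh.
have I1 := intP n hg; have I2 := intP n hh.
have J1 := intpsi hg; have J2 := intpsi hh.
have Zr (S : _) (U : measurableType S) (mm : {measure set U -> \bar R}) (u : U -> R) :
    mm.-integrable setT (EFin \o u) -> mm.-integrable setT (EFin \o (fun x => c * u x)).
  by move=> iu; apply: (eq_integrable _ (fun x => c%:E * (u x)%:E)%E) => //;
     exact: integrableZl.
rewrite /L RintegralD//; last exact: (Zr _ _ _ _ I2).
rewrite RintegralZl//.
under [in X in _ - X]eq_Rintegral do rewrite mulrDl -mulrA.
rewrite RintegralD//; last exact: (Zr _ _ _ _ J2).
rewrite RintegralZl//.
ring.
Qed.

(** The factor blows up with n. It makes each functional bounded, and it fixes the accuracy to be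
    asked of the approximation at stage n. *)
Let Lle n (h : R -> R) : bounded_away h ->
  `|L n h| <= ((Delta n)^-1 * (Delta n)^-1 + (Delta n)^-1)
              * fine (\int[m n]_x `|h x|%:E)%E.
Proof.
move=> hh; have [mn [B nB] nd] := bounded_awayN hh.
have [mp p0 pE] := Hpsi.
have D0 : 0 <= (Delta n)^-1 by rewrite invr_ge0 ltW.
have a1 : `|\int[P]_w h (X (Delta n) w)| <= fine (\int[m n]_x `|h x|%:E)%E.
  apply: (le_trans (le_normr_Rintegral measurableT (intP n hh))).
  apply: fine_le.
  - apply: integrable_fin_num => //; exact: (intP n (bounded_awayN hh)).
  - by rewrite ge0_fin_numE ?m_lt_pinfty// integral_ge0.
  - rewrite mE// leeDl// integral_ge0// => x _.
    by rewrite lee_fin mulr_ge0.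
have a2 : `|\int[lebesgue_measure]_x (h x * psi x)| <= fine (\int[m n]_x `|h x|%:E)%E.
  apply: (le_trans (le_normr_Rintegral measurableT (intpsi hh))).
  apply: fine_le.
  - by have /integrable_abse := intpsi hh; exact: integrable_fin_num.
  - by rewrite ge0_fin_numE ?m_lt_pinfty// integral_ge0.
  - under eq_integral do rewrite /= normrM (ger0_norm (p0 _)).
    by rewrite mE// leeDr// integral_ge0.
rewrite /L normrM (ger0_norm D0) mulrDl -mulrA -mulrDr ler_wpM2l//.
rewrite (le_trans (ler_normB _ _))// lerD// normrM (ger0_norm D0) ler_wpM2l//.
Qed.

(** The radius [delta] is common to all members: functions that vanish near the origin without a
    common radius would not be closed under uniform limits. *)
Let E := [set g | continuous g /\ bounded_away g].

Let E_uniform_limit (g : R -> R) :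
  (forall e, 0 < e -> exists2 h, E h & forall x, `|g x - h x| <= e) -> E g.
Proof.
move=> Hg.
have cg : continuous g.
  move=> x; apply/cvgrPdist_le => e e0.
  have e30 : 0 < e / 3 by rewrite divr_gt0.
  have [h [ch _] gh] := Hg _ e30.
  have /cvgrPdist_le /(_ _ e30) := ch x.
  apply: filterS => y hxy.
  have := ler_distD (h x) (g x) (g y).
  have := ler_distD (h y) (h x) (g y).
  by have := gh x; have := gh y; rewrite [`|g y - _|]distrC; lra.
split=> //; split; first exact: continuous_measurable_fun.
  have [h [_ [_ [B hB] _]] gh] := Hg _ ltr01.
  exists (B + 1) => x; have := ler_normD (h x) (g x - h x).
  by rewrite addrC subrK; have := gh x; have := hB x; lra.
move=> x xd; apply/eqP; rewrite -normr_le0; apply/ler_addgt0Pl => e e0.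
have [h [_ [_ _ hd]] gh] := Hg _ e0.
by rewrite addr0; have := gh x; rewrite hd// subr0.
Qed.

Let L_pointwise_bounded (g : R -> R) : E g -> exists C, forall n, `|L n g| <= C.
Proof.
move=> [cg [mg [B gB] gd]].
have g0 : \forall x \near (0 : R), g x = 0.
  near=> x; apply: gd; near: x; apply/nbhs_normP; exists delta => //= x.
  by rewrite /= sub0r normrN.
have /eqO_exP[k k0 kP] := Hsmall (ex_intro _ B gB) cg g0.
have kn : \forall n \near \oo, `|L n g| <= k.
  have D0 : Delta n @[n --> \oo] --> 0^'+.
    move=> A [e e0 eA]; have /cvgrPdist_lt/(_ e e0) := Delta0.
    by apply: filterS => n De; apply: eA => //=; exact: De.
  near=> n; have : (Delta @^-1` [set h | `|h^-1 * fine ('E_P[fun w => g (X h w)])%E -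
      \int[lebesgue_measure]_x (g x * psi x)| <= k * `|h| ]) n.
    by near: n; exact: (D0 _ kP).
  rewrite /= unlock (gtr0_norm (Delta_gt0 n)) => h.
  rewrite /L normrM gtr0_norm ?invr_gt0// mulrC ler_pdivrMr//.
have [n0 _ n0P] := kn.
(* The small-time property controls $n \ge n_0$ only; the sum absorbs the finitely many earlier
   indices. *)
exists (k + \sum_(i < n0) `|L i g|) => n.
have [n0n|nn0] := leqP n0 n.
  by apply: (le_trans (n0P n n0n)); rewrite lerDl sumr_ge0.
rewrite (bigD1 (Ordinal nn0))//= addrCA lerDl addr_ge0 ?sumr_ge0// ltW//.
Unshelve. all: by end_near. Qed.

(** For each n, [f] is replaced by some [g] in [E] with $|g| \le B$ and $|L_n(f-g)| \le 1$, while
    uniform boundedness controls $L_n g$ by a constant free of n. The gap between [delta] and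
    [delta + delta] leaves room for a continuous cutoff. *)
Lemma small_time_rate (f : R -> R) (B : R) : measurable_fun setT f ->
  (forall x, `|f x| <= B) -> (forall x, `|x| < delta + delta -> f x = 0) ->
  exists C, forall n, `|(Delta n)^-1 * \int[P]_w f (X (Delta n) w)
    - \int[lebesgue_measure]_x (f x * psi x)| <= C * Delta n.
Proof.
move=> mf fB fd.
have B0 : 0 <= B by exact: le_trans (fB 0).
pose N n := ((Delta n)^-1 * (Delta n)^-1 + (Delta n)^-1).
have N0 n : 0 < N n by rewrite addr_gt0 ?mulr_gt0 ?invr_gt0.
have Lbnd n g b : E g -> (forall x, `|g x| <= b) ->
    `|L n g| <= N n * fine (m n setT) * b.
  move=> [_ Mg] gb; have mfin : m n setT \is a fin_num.
    by rewrite ge0_fin_numE// m_fin.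
  apply: (le_trans (Lle n Mg)); rewrite -mulrA ler_wpM2l//; first exact/ltW/N0.
  rewrite -lee_fin EFinM !fineK//; last first.
    by rewrite ge0_fin_numE ?m_lt_pinfty// integral_ge0.
  rewrite muleC -integral_cst//; apply: ge0_le_integral => //.
  - by case: (bounded_awayN Mg) => mn _ _; exact/measurable_EFinP.
  - by move=> x _; rewrite lee_fin.
have E0 : E (fun=> 0).
  split; first by move=> x; exact: cvg_cst.
  by split=> //; exists 0 => x; rewrite normr0.
have ED g h c : E g -> E h -> E (fun x => g x + c * h x).
  move=> [cg Mg] [ch Mh]; split; last exact: bounded_awayD.
  by move=> x; apply: cvgD; [exact: cg|apply: cvgM; [exact: cvg_cst|exact: ch]].
have [C hC] := @uniform_boundedness R R E L (fun n => N n * fine (m n setT))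
  E0 ED E_uniform_limit (fun n g h c Eg Eh => Llin n c Eg.2 Eh.2) Lbnd
  L_pointwise_bounded.
have Mf : bounded_away f.
  split=> //; first by exists B.
  by move=> x xd; apply: fd; rewrite (lt_trans xd)// ltrDl.
(* [B + 1] replaces [B] because the uniform bound asks for a positive radius and [B] may be 0; the
   last 1 is the approximation error. *)
suff Lf n : `|L n f| <= C * (B + 1) + 1.
  exists (C * (B + 1) + 1) => n; have := Lf n; rewrite /L.
  by rewrite normrM gtr0_norm ?invr_gt0// mulrC ler_pdivrMr.
(* The accuracy $1/N_n$ cancels the factor of [Lle], so that $|L_n(f-g)| \le 1$. *)
have [_ /(_ (N n)^-1)[|g0 [cg0 _ Ig0]]] := L1approx_bounded (m_fin n) mf fB.
  by rewrite invr_gt0.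
(* [chi] rises from 0 on $|x|\le\delta$ to 1 on $|x|\ge 2\delta$, and [clip] truncates [g0] to
   $[-B,B]$. *)
pose chi (x : R) : R := Num.max 0 (Num.min 1 (`|x| / delta - 1)).
pose clip x : R := Num.max (- B) (Num.min B (g0 x)).
pose g x := chi x * clip x.
have chi01 x : 0 <= chi x <= 1.
  by rewrite /chi le_max lexx/= ge_max ler01 ge_min lexx.
have clipB x : `|clip x| <= B.
  by rewrite ler_norml /clip le_max lexx/= ge_max ge_min lexx andbT; lra.
have chi0 x : `|x| < delta -> chi x = 0.
  move=> xd; apply/max_idPl; rewrite ge_min subr_le0 ler_pdivrMr// mul1r.
  by rewrite (ltW xd) orbT.
have chi1 x : delta + delta <= `|x| -> chi x = 1.
  move=> xd; rewrite /chi (_ : Num.min 1 _ = 1); first exact/max_idPr.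
  by apply/min_idPl; rewrite lerBrDr ler_pdivlMr// mulrDl mul1r.
have gB x : `|g x| <= B + 1.
  have /andP[c0 c1] := chi01 x; rewrite normrM (ger0_norm c0).
  by apply: (@le_trans _ _ (1 * B)); [exact: ler_pM|lra].
have cg : continuous g.
  move=> x; apply: cvgM.
    apply: (@continuous_max R R (cst 0) (fun x => Num.min 1 (`|x| / delta - 1))).
      exact: cvg_cst.
    apply: (@continuous_min R R (cst 1) (fun x => `|x| / delta - 1)).
      exact: cvg_cst.
    apply: cvgB; last exact: cvg_cst.
    by apply: cvgM; [exact: norm_continuous|exact: cvg_cst].
  apply: (@continuous_max R R (cst (- B)) (fun x => Num.min B (g0 x))).
    exact: cvg_cst.
  apply: (@continuous_min R R (cst B) g0); [exact: cvg_cst|exact: cg0].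
have Eg : E g.
  split=> //; split; [exact: continuous_measurable_fun|by exists (B + 1)|].
  by move=> x xd; rewrite /g chi0// mul0r.
(* Neither modification worsens the approximation: where [chi] is 1, truncation moves [g0] towards
   [f], whose values lie in $[-B,B]$; elsewhere [f] is 0 and both operations shrink $|g_0|$. *)
have fg x : `|f x + -1 * g x| <= `|f x - g0 x|.
  rewrite mulN1r; have [xd|xd] := leP (delta + delta) `|x|.
    rewrite /g chi1// mul1r; have := fB x; rewrite /clip ler_norml => /andP[].
    case: (leP B (g0 x)) => h1;
      [case: (leP (- B) B)|case: (leP (- B) (g0 x))] => h2 h3 h4;
    have := ler_norm (f x - g0 x); have := ler_norm (g0 x - f x);
    by rewrite [`|g0 x - _|]distrC => h5 h6; rewrite ler_norml; apply/andP; split; lra.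
  rewrite fd// !sub0r !normrN normrM.
  have /andP[c0 c1] := chi01 x; rewrite (ger0_norm c0).
  apply: (@le_trans _ _ (1 * `|clip x|)); first by rewrite ler_wpM2r.
  rewrite mul1r /clip.
  case: (leP B (g0 x)) => h1;
    [case: (leP (- B) B)|case: (leP (- B) (g0 x))] => h2;
  have := ler_norm (g0 x); have := ler_norm (- g0 x); rewrite normrN => h5 h6;
  by rewrite ler_norml; apply/andP; split; lra.
have Mfg := bounded_awayD (-1) Mf Eg.2.
have := Lle n Mfg; rewrite Llin//; last exact: Eg.2.
rewrite -/(N n) => hL.
have I1 : fine (\int[m n]_x `|f x + -1 * g x|%:E)%E <= (N n)^-1.
  rewrite -lee_fin fineK; last by rewrite ge0_fin_numE ?m_lt_pinfty// integral_ge0.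
  apply: le_trans Ig0; apply: ge0_le_integral => //.
  - by case: (bounded_awayN Mfg) => mn _ _; exact/measurable_EFinP.
  - apply/measurable_EFinP; apply: measurableT_comp => //.
    by apply: measurable_funB => //; exact: continuous_measurable_fun.
  - by move=> x _; rewrite lee_fin.
have : N n * fine (\int[m n]_x `|f x + -1 * g x|%:E)%E <= 1.
  by apply: (le_trans (ler_wpM2l (ltW (N0 n)) I1)); rewrite divff// lt0r_neq0.
have := hC n g (B + 1) Eg _ gB; rewrite ltr_wpDl// => /(_ isT).
have := ler_normD (L n f - L n g) (L n g); rewrite subrK.
by move: hL; rewrite mulN1r; lra.
Qed.

End small_time_bound.

(** * Mean squared error of the estimator *)

Lemma Rintegral_sum d (T : measurableType d) (R : realType)
    (m : {measure set T -> \bar R}) (D : set T) (I : Type) (s : seq I)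
    (F : I -> T -> R) : measurable D ->
  (forall i, m.-integrable D (EFin \o F i)) ->
  m.-integrable D (EFin \o (fun x => \sum_(i <- s) F i x)) /\
  \int[m]_(x in D) (\sum_(i <- s) F i x) = \sum_(i <- s) \int[m]_(x in D) F i x.
Proof.
move=> mD iF; elim: s => [|i s [IHi IHe]].
  under eq_fun do rewrite big_nil.
  rewrite big_nil (_ : EFin \o _ = cst 0%E)//; split; first exact: integrable0.
  by rewrite Rintegral_cst// mul0r.
under eq_fun do rewrite big_cons.
split; first exact: (integrableD mD (iF i) IHi).
by rewrite big_cons RintegralD// IHe.
Qed.

Lemma probability_bounded_integrable d (T : measurableType d) (R : realType)
    (P : probability T R) (f : T -> R) (B : R) :
  measurable_fun setT f -> (forall x, `|f x| <= B) ->
  P.-integrable setT (EFin \o f).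
Proof.
apply: bounded_integrable.
exact: (le_lt_trans (probability_le1 P measurableT) (ltry 1)).
Qed.

(** Independence on rectangles identifies the joint law with the product of the marginal laws;
    Fubini then separates the two factors. *)
Lemma indep_Rintegral_mul d (T : measurableType d) (R : realType)
    (P : probability T R) (Y Z : {RV P >-> R}) (g h : R -> R) (Bg Bh : R) :
  (forall A B : set R, measurable A -> measurable B ->
    P (Y @^-1` A `&` Z @^-1` B) = (P (Y @^-1` A) * P (Z @^-1` B))%E) ->
  measurable_fun setT g -> measurable_fun setT h ->
  (forall x, `|g x| <= Bg) -> (forall x, `|h x| <= Bh) ->
  \int[P]_w (g (Y w) * h (Z w)) = \int[P]_w g (Y w) * \int[P]_w h (Z w).
Proof.
move=> indep mg mh gB hB.
have mYZ : measurable_fun setT (fun w => (Y w, Z w)) by exact: measurable_fun_pair.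
pose YZ : {RV P >-> (R * R)%type} :=
  MeasurableFun.Pack (MeasurableFun.Class (isMeasurableFun.Build _ _ _ _ _ mYZ)).
have lawYZ A : measurable A ->
    (distribution P Y \x distribution P Z)%E A = distribution P YZ A.
  by apply: product_measure_unique => B C mB mC; rewrite /= -indep.
pose F (z : R * R) : R := g z.1 * h z.2.
have mF : measurable_fun setT F.
  apply: measurable_funM.
    exact: (measurableT_comp mg measurable_fst).
  exact: (measurableT_comp mh measurable_snd).
have FB z : `|F z| <= Bg * Bh by rewrite normrM ler_pM.
have intF (Q : probability (R * R)%type R) : Q.-integrable setT (EFin \o F).
  exact: (@probability_bounded_integrable _ _ _ _ _ (Bg * Bh)).
have inth : P.-integrable setT (EFin \o (h \o Z)).
  by apply: (@probability_bounded_integrable _ _ _ _ _ Bh);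
    [exact: measurableT_comp|move=> x; exact: hB].
have intg : P.-integrable setT (EFin \o (g \o Y)).
  by apply: (@probability_bounded_integrable _ _ _ _ _ Bg);
    [exact: measurableT_comp|move=> x; exact: gB].
have -> : \int[P]_w (g (Y w) * h (Z w)) = fine (\int[distribution P YZ]_z (F z)%:E)%E.
  rewrite (@integral_distribution _ _ _ _ _ P YZ (EFin \o F))//.
  - exact/measurable_EFinP.
  - apply: (@probability_bounded_integrable _ _ _ _ _ (Bg * Bh)); last by move=> x; exact: FB.
    exact: (measurableT_comp mF).
have -> : (\int[distribution P YZ]_z (F z)%:E =
    \int[distribution P Y \x distribution P Z]_z (F z)%:E)%E.
  by apply: eq_measure_integral => A mA _; exact: esym (lawYZ A mA).
rewrite -integral12_prod_meas1; last exact: intF.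
rewrite /fubini_F.
have lawI (W : {RV P >-> R}) (k : R -> R) : measurable_fun setT k ->
    P.-integrable setT (EFin \o (k \o W)) ->
    (\int[distribution P W]_y (k y)%:E = (\int[P]_w k (W w))%:E)%E.
  move=> mk ik; rewrite (@integral_distribution _ _ _ _ _ P W (EFin \o k))//.
    by rewrite /Rintegral fineK//; exact: integrable_fin_num ik.
  exact/measurable_EFinP.
have -> : (\int[distribution P Y]_x \int[distribution P Z]_y (F (x, y))%:E =
    \int[distribution P Y]_x (g x * \int[P]_w h (Z w))%:E)%E.
  apply: eq_integral => x _; rewrite /F /=.
  under eq_integral do rewrite EFinM.
  rewrite integralZl//; last exact: (@probability_bounded_integrable _ _ _ _ _ Bh).
  by rewrite lawI.
rewrite lawI.
- by rewrite /= RintegralZr.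
- exact: measurable_funM.
- apply: (@probability_bounded_integrable _ _ _ _ _ (Bg * `|\int[P]_w h (Z w)|)).
    by apply: measurable_funM => //; exact: measurableT_comp.
  by move=> w; rewrite /= normrM ler_wpM2r.
Qed.

Lemma uncorrelated_sum_sqr d (T : measurableType d) (R : realType)
    (P : probability T R) n (Z : 'I_n -> T -> R) (B v : R) :
  (forall i, measurable_fun setT (Z i)) -> (forall i x, `|Z i x| <= B) ->
  (forall i j, i != j -> \int[P]_w (Z i w * Z j w) = 0) ->
  (forall i, \int[P]_w (Z i w * Z i w) <= v) ->
  \int[P]_w (\sum_(i < n) Z i w) ^+ 2 <= n%:R * v.
Proof.
move=> mZ ZB Z0 Zv.
have ZZB i j x : `|Z i x * Z j x| <= B * B by rewrite normrM ler_pM.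
have mZZ i j : measurable_fun setT (fun w => Z i w * Z j w).
  exact: measurable_funM.
under eq_Rintegral do rewrite expr2 big_distrlr/=.
have iZZ i j : P.-integrable setT (EFin \o (fun w => Z i w * Z j w)).
  exact: (probability_bounded_integrable P (mZZ i j) (ZZB i j)).
have iS i := (Rintegral_sum (index_enum 'I_n) measurableT (iZZ i)).1.
rewrite (Rintegral_sum (index_enum 'I_n) measurableT iS).2.
apply: (@le_trans _ _ (\sum_(i < n) v)); last first.
  by rewrite sumr_const card_ord mulr_natl.
apply: ler_sum => i _; rewrite (Rintegral_sum _ measurableT (iZZ i)).2.
by rewrite (bigD1 i)//= big1 ?addr0// => j ji; rewrite Z0// eq_sym.
Qed.

Section levy_increments.
Variables (d : measure_display) (T : measurableType d) (R : realType).
Variables (P : probability T R) (X : R -> {RV P >-> R}).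
Variables (mu sigma : R) (Psi : {measure set R -> \bar R}).
Hypothesis HX : levy_process X mu sigma Psi.
Variables (D : R).
Hypothesis D_gt0 : 0 < D.

Let mincr i : measurable_fun setT (increment X D i).
Proof. by apply: measurable_funB. Qed.

Let W i : {RV P >-> R} :=
  MeasurableFun.Pack (MeasurableFun.Class (isMeasurableFun.Build _ _ _ _ _ (mincr i))).

Let W_law i (A : set R) : measurable A -> P (W i @^-1` A) = P (X D @^-1` A).
Proof.
move=> mA; have := levy_stationary_increments HX (s := i%:R * D) (h := D) (B := A).
rewrite (_ : i%:R * D + D = i.+1%:R * D); last by rewrite -natr1 mulrDl mul1r.
by apply=> //; [rewrite mulr_ge0// ltW|exact: ltW].
Qed.

Let W_indep n (i j : 'I_n) (A B : set R) : i != j -> measurable A -> measurable B ->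
  P (W i @^-1` A `&` W j @^-1` B) = (P (W i @^-1` A) * P (W j @^-1` B))%E.
Proof.
move=> ij mA mB.
have := levy_independent_increments HX (m := n) (t := fun k => k%:R * D).
rewrite mul0r => /(_ (lexx _)) h.
(* Pairwise independence is read off the mutual one by leaving every other increment
   unconstrained. *)
pose C (k : 'I_n) : set R := if k == i then A else if k == j then B else setT.
have := h _ C; have -> : \bigcap_(k in [set: 'I_n])
    (fun w => X (k.+1%:R * D) w - X (k%:R * D) w) @^-1` C k =
    W i @^-1` A `&` W j @^-1` B.
  apply/seteqP; split => [w Cw|w [Aw Bw] k _] /=.
    split; first by have := Cw i I; rewrite /C /= eqxx.
    by have := Cw j I; rewrite /C /= eq_sym (negbTE ij) eqxx.
  rewrite /C; case: eqP => [->//|_]; case: eqP => [->//|_].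
  by [].
move=> ->; first last.
- by move=> k; rewrite /C; case: ifP => // _; case: ifP.
- by move=> k l kl; rewrite ler_wpM2r ?ler_nat// ltW.
rewrite (bigD1 i)//= (bigD1 j)/=; last by rewrite eq_sym.
rewrite big1 ?mule1.
  by rewrite /C eqxx eq_sym (negbTE ij) eqxx.
move=> k /andP[ki kj]; rewrite /C (negbTE ki) (negbTE kj).
by rewrite preimage_setT probability_setT.
Qed.

Let W_Rintegral i (k : R -> R) (B : R) : measurable_fun setT k ->
  (forall x, `|k x| <= B) -> \int[P]_w k (W i w) = \int[P]_w k (X D w).
Proof.
move=> mk kB.
have E (V : {RV P >-> R}) :
    (\int[P]_w (k (V w))%:E = \int[distribution P V]_y (k y)%:E)%E.
  rewrite (@integral_distribution _ _ _ _ _ P V (EFin \o k))//.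
    exact/measurable_EFinP.
  apply: (@probability_bounded_integrable _ _ _ _ _ B); last by move=> x; exact: kB.
  exact: measurableT_comp.
rewrite /Rintegral !E; congr fine.
by apply: eq_measure_integral => A mA _; exact: W_law.
Qed.

(** The error is a centred sum plus the bias, and $(x+y)^2\le 2x^2+2y^2$ separates them. The
    variance of each term is bounded by its second moment, which is of order [D] in small time. *)
Lemma empirical_mean_mse (f : R -> R) (B c : R) n : measurable_fun setT f ->
  (forall x, `|f x| <= B) -> (0 < n)%N ->
  \int[P]_w ((n%:R * D)^-1 * (\sum_(i < n) f (increment X D i w)) - c) ^+ 2 <=
  2 * ((n%:R * D ^+ 2)^-1 * \int[P]_w (f (X D w)) ^+ 2)
  + 2 * (D^-1 * \int[P]_w f (X D w) - c) ^+ 2.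
Proof.
move=> mf fB n0; have nR : 0 < n%:R :> R by rewrite ltr0n.
have B0 : 0 <= B by exact: le_trans (fB 0).
set m := \int[P]_w f (X D w).
have intW i (k : R -> R) K : measurable_fun setT k -> (forall x, `|k x| <= K) ->
    P.-integrable setT (EFin \o (fun w => k (W i w))).
  move=> mk kK; apply: (@probability_bounded_integrable _ _ _ _ _ K) => //.
  exact: measurableT_comp.
pose Z (i : 'I_n) w := f (W i w) - m.
have mZ i : measurable_fun setT (Z i).
  by apply: measurable_funB => //; exact: measurableT_comp.
have ZB i x : `|Z i x| <= B + `|m|.
  by rewrite (le_trans (ler_normB _ _))// lerD2r.
have mfm : measurable_fun setT (fun x => f x - m) by exact: measurable_funB.
have fmB x : `|f x - m| <= B + `|m|.
  by rewrite (le_trans (ler_normB _ _))// lerD2r.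
have Pcst (r : R) : \int[P]_w r = r.
  by rewrite Rintegral_cst// [fine _](congr1 fine (probability_setT P)) mulr1.
have Pint r : P.-integrable setT (EFin \o cst r).
  exact: (@probability_bounded_integrable _ _ _ _ _ `|r|).
have Zm i : \int[P]_w Z i w = 0.
  rewrite RintegralB//; [|exact: intW mf fB|exact: Pint].
  by rewrite Pcst (W_Rintegral _ mf fB) subrr.
have Z0 (i j : 'I_n) : i != j -> \int[P]_w (Z i w * Z j w) = 0.
  move=> ij; rewrite (@indep_Rintegral_mul _ _ _ P (W i) (W j)
    (fun x => f x - m) (fun x => f x - m) (B + `|m|) (B + `|m|))//.
    by have := Zm i; rewrite /Z => ->; rewrite mul0r.
  by move=> *; exact: W_indep.
have mf2 : measurable_fun setT (fun x => f x ^+ 2) by exact: measurable_funX.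
have f2B x : `|f x ^+ 2| <= B ^+ 2.
  by rewrite normrX lerXn2r// nnegrE.
set v := \int[P]_w (f (X D w)) ^+ 2.
have Zv i : \int[P]_w (Z i w * Z i w) <= v.
  have -> : \int[P]_w (Z i w * Z i w) =
      \int[P]_w (f (W i w) ^+ 2 - (2 * m * f (W i w) - m ^+ 2)).
    by apply: eq_Rintegral => w _; rewrite /Z; ring.
  have I1 : P.-integrable setT (EFin \o (fun w => 2 * m * f (W i w))).
    apply: (@intW i (fun x => 2 * m * f x) (`|2 * m| * B)).
      exact: measurable_funM.
    by move=> x; rewrite normrM ler_wpM2l.
  have I2 : P.-integrable setT (EFin \o (fun w => 2 * m * f (W i w) - m ^+ 2)).
    apply: (@intW i (fun x => 2 * m * f x - m ^+ 2) (`|2 * m| * B + `|m ^+ 2|)).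
      by apply: measurable_funB => //; exact: measurable_funM.
    by move=> x; rewrite (le_trans (ler_normB _ _))// lerD2r normrM ler_wpM2l.
  rewrite RintegralB//; last exact: intW mf2 f2B.
  rewrite RintegralB//; last exact: Pint.
  rewrite RintegralZl//; last exact: intW mf fB.
  rewrite Pcst (W_Rintegral _ mf fB) (W_Rintegral _ mf2 f2B) -/v -/m.
  by have := sqr_ge0 m; lra.
have key := uncorrelated_sum_sqr mZ ZB Z0 Zv.
pose S w := \sum_(i < n) Z i w.
have mS : measurable_fun setT S by exact: measurable_sum.
have SB x : `|S x| <= n%:R * (B + `|m|).
  rewrite (le_trans (ler_norm_sum _ _ _))//.
  apply: (@le_trans _ _ (\sum_(i < n) (B + `|m|))); first exact: ler_sum.
  by rewrite sumr_const card_ord mulr_natl.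
set t := n%:R * D; have t0 : 0 < t by rewrite mulr_gt0.
have decomp w : t^-1 * (\sum_(i < n) f (increment X D i w)) - c =
    t^-1 * S w + (D^-1 * m - c).
  rewrite /S /Z sumrB sumr_const card_ord -mulr_natl.
  rewrite (_ : D^-1 * m = t^-1 * (n%:R * m)); last first.
    by rewrite /t invfM mulrACA mulVf ?mul1r// gt_eqF.
  by rewrite mulrBr; lra.
set b := D^-1 * m - c.
have IS2 : P.-integrable setT (EFin \o (fun w => S w ^+ 2)).
  apply: (@probability_bounded_integrable _ _ _ _ _ ((n%:R * (B + `|m|)) ^+ 2)).
    exact: measurable_funX.
  by move=> x; rewrite normrX lerXn2r// nnegrE// (le_trans _ (SB x)).
have Ilhs : P.-integrable setT (EFin \o (fun w => (t^-1 * S w + b) ^+ 2)).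
  apply: (@probability_bounded_integrable _ _ _ _ _
    ((t^-1 * (n%:R * (B + `|m|)) + `|b|) ^+ 2)).
    by apply: measurable_funX; apply: measurable_funD => //; exact: measurable_funM.
  have t1 : 0 < t^-1 by rewrite invr_gt0.
  move=> x; rewrite normrX lerXn2r ?nnegrE//.
    by rewrite addr_ge0// mulr_ge0 ?(ltW t1)// mulr_ge0// addr_ge0.
  rewrite (le_trans (ler_normD _ _))// lerD2r normrM gtr0_norm//.
  by rewrite ler_wpM2l// ltW.
have IZ (r : R) : P.-integrable setT (EFin \o (fun w => r * S w ^+ 2)).
  by apply: (eq_integrable _ (fun w => r%:E * (S w ^+ 2)%:E)%E) => //; exact: integrableZl.
under eq_Rintegral do rewrite decomp -/b.
apply: (@le_trans _ _ (\int[P]_w (2 * (t^-1) ^+ 2 * S w ^+ 2 + 2 * b ^+ 2))).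
  apply: le_Rintegral => //.
    exact: (integrableD measurableT (IZ _) (Pint _)).
  move=> w _; have := sqr_ge0 (t^-1 * S w - b); nra.
rewrite RintegralD//; last exact: Pint.
rewrite Pcst RintegralZl// lerD2r -mulrA ler_wpM2l//.
apply: (@le_trans _ _ (t^-1 ^+ 2 * (n%:R * v))).
  by rewrite ler_wpM2l// sqr_ge0.
rewrite le_eqVlt; apply/orP; left; apply/eqP.
by rewrite /t; field; rewrite !gt_eqF.
Qed.

End levy_increments.

(** * Sieve functions in L2 *)

Section L2norm_sieve.
Variables (R : realType) (a b : R) (K : nat) (f : 'I_K -> R -> R).
Hypothesis Hf : sieve a b f.
Local Notation D := (`[a, b]%classic : set R).
Local Notation leb := (@lebesgue_measure R).

Lemma measurable_sieve_fun (theta : 'rV[R]_K) : measurable_fun setT (sieve_fun f theta).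
Proof.
apply: measurable_sum => k; apply: measurable_funM => //.
exact: (sieve_measurable Hf).
Qed.

Lemma L2normE (g : R -> R) : measurable_fun setT g ->
  L2norm a b g = ((\int[leb]_(x in D) (g x ^+ 2)%:E) `^ 2^-1)%E.
Proof.
move=> mg; rewrite /L2norm unlock; congr (_ `^ _)%E.
rewrite -(@ge0_integral_mrestr _ _ _ leb _ (measurable_itv `[a, b]) (fun x => g x ^+ 2)).
- by apply: eq_integral => x _ /=; rewrite ?poweR_EFin powR_mulrn// real_normK// num_real.
- by apply: measurable_funX.
- by move=> x; exact: sqr_ge0.
Qed.

Let lebD_fin : (leb D < +oo)%E.
Proof. by rewrite lebesgue_measure_itv/=; case: ifP => _; rewrite -?EFinB ltry. Qed.

Lemma sieve_bounded_integrable (g : R -> R) B : measurable_fun setT g ->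
  (forall x, `|g x| <= B) -> leb.-integrable D (EFin \o g).
Proof.
move=> mg gB; apply: measurable_bounded_integrable => //.
  exact: measurable_funTS.
exists B; split; first exact: num_real.
by move=> x Bx y _; apply: le_trans (gB y) (ltW Bx).
Qed.

Lemma sieve_uniformly_bounded : exists B, 0 <= B /\ forall k x, `|f k x| <= B.
Proof.
have /choice[B HB] := sieve_bounded Hf.
exists (\sum_(k < K) `|B k|); split; first exact: sumr_ge0.
move=> k x; apply: (le_trans (HB k x)); apply: (le_trans (ler_norm _)).
by rewrite (bigD1 k)//= lerDl sumr_ge0.
Qed.

Lemma Rintegral_sieve_mul k (theta : 'rV[R]_K) :
  \int[leb]_(x in D) (f k x * sieve_fun f theta x) = theta ord0 k.
Proof.
have [B [B0 fB]] := sieve_uniformly_bounded.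
have mf k := sieve_measurable Hf k.
pose F j x := theta ord0 j * (f k x * f j x).
have iF j : leb.-integrable D (EFin \o F j).
  apply: (@sieve_bounded_integrable _ (`|theta ord0 j| * (B * B))).
    by apply: measurable_funM => //; exact: measurable_funM.
  by move=> x; rewrite normrM ler_wpM2l// normrM ler_pM.
transitivity (\int[leb]_(x in D) (\sum_(j < K) F j x)).
  apply: eq_Rintegral => x _; rewrite /sieve_fun mulr_sumr.
  by apply: eq_bigr => j _; rewrite /F mulrCA.
rewrite (Rintegral_sum _ _ iF).2// (bigD1 k)//= big1 => [|j jk].
  rewrite addr0 RintegralZl//.
    by rewrite /Rintegral (sieve_orthonormal Hf) eqxx /= mulr1.
  apply: (@sieve_bounded_integrable _ (B * B)); first exact: measurable_funM.
  by move=> x; rewrite normrM ler_pM.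
rewrite RintegralZl//.
  by rewrite /Rintegral (sieve_orthonormal Hf) eq_sym (negbTE jk) /= mulr0.
apply: (@sieve_bounded_integrable _ (B * B)); first exact: measurable_funM.
by move=> x; rewrite normrM ler_pM.
Qed.

Lemma sieve_fun_bounded (theta : 'rV[R]_K) : exists B, forall x, `|sieve_fun f theta x| <= B.
Proof.
have [B [B0 fB]] := sieve_uniformly_bounded.
exists (\sum_(k < K) `|theta ord0 k| * B) => x.
rewrite (le_trans (ler_norm_sum _ _ _))// ler_sum// => k _.
by rewrite normrM ler_wpM2l.
Qed.

(** Parseval's identity: it turns $L_2(D)$ distances between sieve functions into Euclidean
    distances between coefficients. *)
Lemma L2norm_sieve_fun (theta : 'rV[R]_K) :
  L2norm a b (sieve_fun f theta) = (Num.sqrt (dotrV theta theta))%:E.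
Proof.
have mg := measurable_sieve_fun theta; have [C gC] := sieve_fun_bounded theta.
have [B [B0 fB]] := sieve_uniformly_bounded.
have mf k := sieve_measurable Hf k.
rewrite L2normE//.
have I2 : leb.-integrable D (EFin \o (fun x => sieve_fun f theta x ^+ 2)).
  apply: (@sieve_bounded_integrable _ (C * C)); first exact: measurable_funX.
  by move=> x; rewrite expr2 normrM ler_pM.
rewrite -[X in (X `^ _)%E]fineK; last exact: integrable_fin_num I2.
rewrite poweR_EFin powR12_sqrt ?fine_ge0 ?integral_ge0//; last first.
  by move=> x _; rewrite lee_fin sqr_ge0.
congr (Num.sqrt _)%:E; rewrite -/(Rintegral _ _ _).
pose F k x := theta ord0 k * (f k x * sieve_fun f theta x).
have IF k : leb.-integrable D (EFin \o (fun x => f k x * sieve_fun f theta x)).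
  apply: (@sieve_bounded_integrable _ (B * C)); first exact: measurable_funM.
  by move=> x; rewrite normrM ler_pM.
have iF j : leb.-integrable D (EFin \o F j).
  apply: (@sieve_bounded_integrable _ (`|theta ord0 j| * (B * C))).
    by apply: measurable_funM => //; exact: measurable_funM.
  by move=> x; rewrite normrM ler_wpM2l// normrM ler_pM.
transitivity (\int[leb]_(x in D) (\sum_(j < K) F j x)).
  apply: eq_Rintegral => x _; rewrite expr2 {1}/sieve_fun mulr_suml.
  by apply: eq_bigr => j _; rewrite /F mulrA.
rewrite (Rintegral_sum _ _ iF).2//; apply: eq_bigr => k _.
by rewrite RintegralZl// Rintegral_sieve_mul.
Qed.

Lemma sieve_funB (theta theta' : 'rV[R]_K) :
  (sieve_fun f theta \- sieve_fun f theta')%R = sieve_fun f (theta - theta').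
Proof.
apply/funext => x; rewrite /sieve_fun /= -sumrB; apply: eq_bigr => k _.
by rewrite !mxE mulrBl.
Qed.

Section in_span.
Variables (psi : R -> R) (theta : 'rV[R]_K).
Hypothesis mpsi : measurable_fun setT psi.
Hypothesis psiE : {ae leb, forall x, D x -> psi x = sieve_fun f theta x}.

(** The projection coefficients depend only on the almost-everywhere class of [psi] on [D], and
    orthonormality recovers [theta] from it. *)
Lemma theta_perp_in_span : theta_perp a b f psi = theta.
Proof.
apply/rowP => k; rewrite mxE -[RHS](Rintegral_sieve_mul k theta).
congr fine; apply: ae_eq_integral => //.
- apply/measurable_EFinP; apply: measurable_funTS; apply: measurable_funM => //.
  exact: (sieve_measurable Hf).
- apply/measurable_EFinP; apply: measurable_funTS; apply: measurable_funM => //.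
    exact: (sieve_measurable Hf).
  exact: measurable_sieve_fun.
- have [N [mN N0 sN]] := psiE; exists N; split=> // x /= nx.
  by apply: sN => /= h; apply: nx => Dx; rewrite h.
Qed.

Lemma L2norm_in_span (theta' : 'rV[R]_K) :
  L2norm a b (sieve_fun f theta' \- psi)%R =
  L2norm a b (sieve_fun f theta' \- sieve_fun f theta)%R.
Proof.
have mt' := measurable_sieve_fun theta'; have mt := measurable_sieve_fun theta.
have m1 : measurable_fun setT (sieve_fun f theta' \- psi)%R by exact: measurable_funB.
have m2 : measurable_fun setT (sieve_fun f theta' \- sieve_fun f theta)%R.
  exact: measurable_funB.
rewrite !L2normE//; congr (_ `^ _)%E; apply: ae_eq_integral => //.
- by apply/measurable_EFinP/measurable_funTS; exact: measurable_funX.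
- by apply/measurable_EFinP/measurable_funTS; exact: measurable_funX.
- have [N [mN N0 sN]] := psiE; exists N; split=> // x /= nx.
  by apply: sN => /= h; apply: nx => Dx; rewrite h.
Qed.

End in_span.

End L2norm_sieve.

(** * Prior mass and the Gibbs posterior *)

(* Dyadic shells: on [4^(j-1) < u / e^2 <= 4^j] the exponential is of order
   [2^-(j(K+1))], while the shell has mass of order [(2^j e)^K]. *)
Lemma gaussian_integral_le d (T : measurableType d) (R : realType)
    (Q : {measure set T -> \bar R}) (u : T -> R) (K : nat) (C kappa : R) :
  measurable_fun setT u -> (forall x, 0 <= u x) -> 0 <= C -> 0 < kappa ->
  (forall s : R, 0 < s -> (Q [set x | (u x <= s ^+ 2)%R] <= (C * s ^+ K)%:E)%E) ->
  exists2 C', 0 <= C' & forall e, 0 < e ->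
    (\int[Q]_x (expR (- (kappa * (u x / e ^+ 2))))%:E <= (C' * e ^+ K)%:E)%E.
Proof.
(* One power more than the growth $s^K$ of the mass leaves a geometric series of ratio 1/2. In [A],
   the 1 serves the innermost ball and the other term comes from $e^{-z}\le n!/z^n$. *)
move=> mu_ u0 C0 k0 Qle; pose n := K.+1.
pose A := 1 + n`!%:R * (4 / kappa) ^+ n.
have A1 : 1 <= A by rewrite lerDl mulr_ge0// exprn_ge0// divr_ge0// ltW.
have A0 : 0 <= A by rewrite (le_trans ler01).
exists (2 * A * C) => [|e e0]; first by rewrite !mulr_ge0.
have alg (p q : R) : 0 < p -> 0 < q ->
    n`!%:R / (q * p) ^+ n = n`!%:R * (4 / q) ^+ n / (4 * p) ^+ n.
  move=> p0 q0; rewrite expr_div_n (exprMn _ q p) (exprMn _ 4 p).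
  have := expf_neq0 n (lt0r_neq0 q0); have := expf_neq0 n (lt0r_neq0 p0).
  have : 4 ^+ n != 0 :> R by rewrite expf_neq0.
  move: (4 ^+ n) (q ^+ n) (p ^+ n) n`!%:R => r s t v *.
  by field; apply/and3P.
(* Full balls stand in for the shells: each point needs only one index whose term dominates, and the
   remaining terms are nonnegative. *)
pose S j : set T := [set x | u x <= (2 ^+ j * e) ^+ 2].
have mS j : measurable (S j).
  rewrite (_ : S j = setT `&` u @^-1` `]-oo, (2 ^+ j * e) ^+ 2]); last first.
    by apply/seteqP; split => x /=; rewrite /S /= in_itv/= => // -[].
  exact: mu_.
pose g j x : \bar R := (A / 2 ^+ (j * n) * \1_(S j) x)%:E.
have c0 j : 0 <= A / 2 ^+ (j * n) by rewrite divr_ge0// exprn_ge0.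
have g0 j x : (0 <= g j x)%E by rewrite lee_fin mulr_ge0.
have mg j : measurable_fun setT (g j).
  by apply/measurable_EFinP; apply: measurable_funM => //; exact: measurable_indic.
have e20 : 0 < e ^+ 2 by rewrite exprn_gt0.
have dom x : ((expR (- (kappa * (u x / e ^+ 2))))%:E <= \sum_(0 <= j <oo) g j x)%E.
  suff [j hj] : exists j, expR (- (kappa * (u x / e ^+ 2))) <= A / 2 ^+ (j * n) /\ S j x.
    apply: (@le_trans _ _ (g j x)).
      by rewrite /g indicE mem_set ?mulr1 ?lee_fin; case: hj.
    apply: (@le_trans _ _ (\sum_(0 <= i < j.+1) g i x)%E).
      by rewrite big_nat_recr//= leeDr// sume_ge0.
    exact: nneseries_lim_ge.
  set y := u x / e ^+ 2.
  have SE j : S j x <-> y <= 4 ^+ j.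
    rewrite /S /= /y ler_pdivrMr// exprMn -exprM mulnC exprM.
    by rewrite (_ : 2 ^+ 2 = 4 :> R); last by rewrite expr2; lra.
  have exj : exists j, y <= 4 ^+ j.
    exists (Num.truncn y).+1; apply: (le_trans (ltW (truncnS_gt y))).
    by rewrite -natrX ler_nat ltnW// ltn_expl.
  (* For the least such index, 0 is handled by $e^{-z}\le 1\le A$; otherwise minimality yields
     $4^j<y$, hence $2^{j+1}\le 4^{j+1}\le 4y$. *)
  case: (ex_minnP exj) => -[|j] yj jmin.
    exists 0%N; split; last exact/SE.
    rewrite mul0n expr0 divr1 (le_trans _ A1)// -[leRHS]expR0 ler_expR.
    by rewrite oppr_le0 mulr_ge0 ?(ltW k0)// divr_ge0// ltW.
  exists j.+1; split; last exact/SE.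
  have yj' : 4 ^+ j < y.
    by rewrite ltNge; apply/negP => /jmin; rewrite ltnn.
  have y0 : 0 < y by rewrite (le_lt_trans _ yj')// exprn_ge0.
  have ky0 : 0 < kappa * y by rewrite mulr_gt0.
  have := expR_ge1Dxn K (ltW ky0); rewrite -/n => hexp.
  have n0 : 0 < n`!%:R :> R by rewrite ltr0n fact_gt0.
  have p0 : 0 < (kappa * y) ^+ n / n`!%:R by rewrite divr_gt0// exprn_gt0.
  rewrite expRN; apply: (@le_trans _ _ ((kappa * y) ^+ n / n`!%:R)^-1).
    by rewrite lef_pV2 ?posrE ?expR_gt0//; lra.
  rewrite invf_div; apply: (@le_trans _ _ (n`!%:R * (4 / kappa) ^+ n / (4 * y) ^+ n)).
    rewrite le_eqVlt; apply/orP; left; apply/eqP.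
    exact: alg.
  apply: ler_pM.
  - by rewrite mulr_ge0// exprn_ge0// divr_ge0// ltW.
  - by rewrite invr_ge0 exprn_ge0// mulr_ge0// ltW.
  - by rewrite /A lerDr.
  - have y4 : 0 < 4 * y by rewrite mulr_gt0.
    rewrite lef_pV2 ?posrE; [|exact: exprn_gt0|exact: exprn_gt0].
    rewrite exprM lerXn2r ?nnegrE ?exprn_ge0 ?(ltW y4)//.
    apply: (@le_trans _ _ (4 ^+ j.+1)); first by rewrite lerXn2r ?nnegrE//; lra.
    by rewrite exprS ler_wpM2l// ltW.
apply: (@le_trans _ _ (\int[Q]_x \sum_(0 <= j <oo) g j x)%E).
  apply: ge0_le_integral => //.
  - apply/measurable_EFinP; apply: measurableT_comp => //.
    by apply: measurableT_comp => //; apply: measurable_funM => //; exact: measurable_funM.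
  - by apply: ge0_emeasurable_sum.
rewrite integral_nneseries//.
have -> : (2 * A * C * e ^+ K)%:E =
    (\sum_(0 <= j <oo) (2 * A * C * e ^+ K / (2 ^ (j + 1))%:R)%:E)%E.
  have := @cvg_geometric_eseries_half R (2 * A * C * e ^+ K) 0.
  by rewrite expr0 divr1 => /cvg_lim <-.
apply: lee_nneseries => [j _ _|j _]; first exact: integral_ge0.
rewrite /g; under eq_integral do rewrite EFinM.
rewrite ge0_integralZl_EFin; [|by []|by move=> x _; rewrite lee_fin
  |by apply/measurable_EFinP; exact: measurable_indic|exact: c0].
rewrite integral_indic// setIT.
apply: (@le_trans _ _ ((A / 2 ^+ (j * n))%:E * (C * (2 ^+ j * e) ^+ K)%:E)%E).
  by rewrite lee_wpmul2l ?lee_fin// Qle// mulr_gt0// exprn_gt0.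
rewrite -EFinM lee_fin natrX le_eqVlt; apply/orP; left; apply/eqP.
rewrite /n mulnS exprD exprMn -exprM addn1 exprS.
have : 2 ^+ j != 0 :> R by rewrite expf_neq0.
have : 2 ^+ (j * K) != 0 :> R by rewrite expf_neq0.
by move: (2 ^+ j) (2 ^+ (j * K)) => p q *; field; apply/andP.
Qed.

Section prior_mass.
Variables (R : realType) (K : nat) (prior : probability 'rV[R]_K R).
Variable theta0 : 'rV[R]_K.
Hypothesis Hprior : prior_density_near prior theta0.

(** A closed sup-norm ball: its Lebesgue measure is a product of lengths, and it fits the entrywise
    topology of row vectors. *)
Definition coord_box (s : R) : set 'rV[R]_K :=
  [set theta | forall i, `[theta0 ord0 i - s, theta0 ord0 i + s]%classic (theta ord0 i)].

Lemma measurable_coord_box s : measurable (coord_box s).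
Proof.
rewrite (_ : coord_box s = \bigcap_(i in setT)
   ((fun v : 'rV[R]_K => v ord0 i) @^-1` `[theta0 ord0 i - s, theta0 ord0 i + s])).
  apply: fin_bigcap_measurable; first exact: finite_finset.
  move=> i _; rewrite -[X in measurable X]setTI.
  exact: measurable_rV_coor.
by apply/seteqP; split => v /= h i => [_|]; exact: h.
Qed.

Lemma lebesgue_coord_box s : 0 < s ->
  lebesgue_rV R K (coord_box s) = ((2 * s) ^+ K)%:E.
Proof.
move=> s0; rewrite (@lebesgue_rV_box R K
  (fun i => `[theta0 ord0 i - s, theta0 ord0 i + s]%classic))//.
rewrite (eq_bigr (fun=> (2 * s)%:E)) => [|i _].
  by rewrite prodEFin prodr_const card_ord.
rewrite lebesgue_measure_itv/= lte_fin ifT; last by lra.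
by rewrite -EFinB; congr (_%:E); lra.
Qed.

Lemma prior_coord_box : exists C c r : R, [/\ 0 <= C, 0 < c, 0 < r,
  forall s, 0 < s -> (prior (coord_box s) <= (C * s ^+ K)%:E)%E &
  forall s, 0 < s -> s <= r -> ((c * s ^+ K)%:E <= prior (coord_box s))%E].
Proof.
have [p [mp p0 priorE [c c0 near_c]]] := Hprior.
have cont : {for theta0, continuous p} by case: (nbhs_singleton near_c).
have near_p : \forall theta \near theta0, p theta <= p theta0 + 1.
  have /cvgrPdist_le /(_ _ ltr01) := cont.
  by apply: filterS => theta; rewrite ler_norml => /andP[]; lra.
have /nbhs_ballP[e /= e0 He] : \forall theta \near theta0,
    c <= p theta <= p theta0 + 1.
  by apply: filterS2 near_c near_p => theta [_ ->] ->.
have pbox s theta : s < e -> coord_box s theta -> c <= p theta <= p theta0 + 1.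
  move=> se bs; apply: He; split=> // i j; rewrite ord1 /ball /= ltr_norml.
  by have := bs j; rewrite /= in_itv/= => /andP[]; lra.
have e20 : 0 < e / 2 by rewrite divr_gt0.
have e2e : e / 2 < e by lra.
have mb s := measurable_coord_box s.
have mps s : measurable_fun (coord_box s) (EFin \o p).
  by apply/measurable_EFinP; exact: measurable_funTS.
have intc s (r : R) : 0 < s ->
    (\int[lebesgue_rV R K]_(x in coord_box s) r%:E = (r * (2 * s) ^+ K)%:E)%E.
  by move=> s0; rewrite EFinM -(lebesgue_coord_box s0); exact: integral_cst.
have M0 : 0 <= p theta0 + 1 by rewrite addr_ge0.
exists ((p theta0 + 1) * 2 ^+ K + (2 / e) ^+ K), (c * 2 ^+ K), (e / 2); split.
- by rewrite addr_ge0 ?mulr_ge0// exprn_ge0// divr_ge0// ltW.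
- by rewrite mulr_gt0// exprn_gt0.
- by [].
- move=> s s0; have [se|es] := ltP s (e / 2).
    rewrite priorE//.
    apply: (@le_trans _ _ (\int[lebesgue_rV R K]_(x in coord_box s) (p theta0 + 1)%:E)%E).
      apply: ge0_le_integral => //.
      + by move=> x _; rewrite lee_fin.
      + by move=> x bx; rewrite lee_fin; have /andP[] := pbox s x (lt_trans se e2e) bx.
    rewrite intc// lee_fin mulrDl.
    have s2 : 0 <= (2 / e) ^+ K * s ^+ K.
      by rewrite mulr_ge0 ?exprn_ge0 ?divr_ge0// ltW.
    by rewrite exprMn mulrA; lra.
  apply: (le_trans (probability_le1 _ _)) => //; rewrite lee_fin mulrDl.
  apply: (@le_trans _ _ ((2 / e) ^+ K * s ^+ K)); last first.
    by rewrite lerDr !mulr_ge0// exprn_ge0// ltW.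
  rewrite -exprMn exprn_ege1//.
  by rewrite mulrAC ler_pdivlMr// mul1r; lra.
- move=> s s0 se; rewrite priorE//.
  apply: (@le_trans _ _ (\int[lebesgue_rV R K]_(x in coord_box s) c%:E)%E).
    rewrite intc// lee_fin.
    by rewrite exprMn mulrA.
  apply: ge0_le_integral => //.
  + by move=> x _; rewrite lee_fin ltW.
  + by move=> x bx; rewrite lee_fin; have /andP[] := pbox s x (le_lt_trans se e2e) bx.
Qed.

End prior_mass.

Section euclidean.
Variables (R : realType) (K : nat).
Implicit Types u v : 'rV[R]_K.

Lemma dotrV_ge0 u : 0 <= dotrV u u.
Proof. by apply: sumr_ge0 => i _; rewrite -expr2 sqr_ge0. Qed.

Lemma measurable_dist (theta0 : 'rV[R]_K) :
  measurable_fun setT (fun theta : 'rV[R]_K => dotrV (theta - theta0) (theta - theta0)).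
Proof.
apply: measurable_sum => k.
have m1 : measurable_fun setT (fun theta : 'rV[R]_K => (theta - theta0) ord0 k).
  under eq_fun do rewrite !mxE.
  by apply: measurable_funB => //; exact: measurable_rV_coor.
exact: measurable_funM.
Qed.

Lemma dist_le_coord_box (theta0 theta : 'rV[R]_K) s : 0 < s ->
  dotrV (theta - theta0) (theta - theta0) <= s ^+ 2 -> coord_box theta0 s theta.
Proof.
move=> s0 h i; rewrite /= in_itv/=.
have : ((theta - theta0) ord0 i) ^+ 2 <= s ^+ 2.
  apply: le_trans h; rewrite /dotrV (bigD1 i)//= -expr2 lerDl sumr_ge0// => j _.
  by rewrite -expr2 sqr_ge0.
by rewrite !mxE => h2; apply/andP; split; nra.
Qed.

Lemma coord_box_dist_le (theta0 theta : 'rV[R]_K) s :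
  coord_box theta0 s theta ->
  dotrV (theta - theta0) (theta - theta0) <= K%:R * s ^+ 2.
Proof.
move=> h; apply: (@le_trans _ _ (\sum_(k < K) s ^+ 2)); last first.
  by rewrite sumr_const card_ord mulr_natl.
apply: ler_sum => i _; rewrite -expr2 !mxE.
by have := h i; rewrite /= in_itv/= => /andP[]; nra.
Qed.

Lemma dist_le2 (x y z : 'rV[R]_K) :
  dotrV (x - z) (x - z) <= 2 * dotrV (x - y) (x - y) + 2 * dotrV (y - z) (y - z).
Proof.
rewrite /dotrV !mulr_sumr -big_split/= ler_sum// => i _; rewrite !mxE.
have := sqr_ge0 (x ord0 i - y ord0 i - (y ord0 i - z ord0 i)); nra.
Qed.

Lemma riskE (th theta : 'rV[R]_K) :
  risk th theta = dotrV (theta - th) (theta - th) - dotrV th th.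
Proof.
rewrite /risk /dotrV mulr_sumr -big_split/= -sumrB; apply: eq_bigr => i _.
by rewrite !mxE; ring.
Qed.

End euclidean.

Section gibbs_posterior.
Variables (R : realType) (K : nat) (f : 'I_K -> R -> R) (omega : R).
Variables (Theta : set 'rV[R]_K) (prior : probability 'rV[R]_K R).
Hypothesis omega_gt0 : 0 < omega.
Hypothesis mTheta : measurable Theta.
Hypothesis prior_Theta : prior Theta = 1%E.

Let weight t (th theta : 'rV[R]_K) := expR (- (omega * t * risk th theta)).

Let sqdist (x y : 'rV[R]_K) := dotrV (x - y) (x - y).

Let weightE t th theta : weight t th theta =
  expR (omega * t * dotrV th th) * expR (- (omega * t * sqdist theta th)).
Proof. by rewrite /weight riskE -expRD /sqdist; congr expR; ring. Qed.

Let mweight t th : measurable_fun setT (weight t th).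
Proof.
rewrite (funext (weightE t th)).
apply: measurable_funM => //; apply: measurableT_comp => //.
apply: measurableT_comp => //; apply: measurable_funM => //.
exact: measurable_dist.
Qed.

Let weight_le t th theta : 0 < t -> weight t th theta <= expR (omega * t * dotrV th th).
Proof.
move=> t0; rewrite weightE ler_piMr ?expR_ge0// -[leRHS]expR0 ler_expR oppr_le0.
by rewrite mulr_ge0 ?dotrV_ge0// mulr_ge0// ltW.
Qed.

Let int_weight t th S : 0 < t -> measurable S ->
  prior.-integrable S (EFin \o weight t th).
Proof.
move=> t0 mS; apply: (integrableS measurableT) => //.
apply: (@probability_bounded_integrable _ _ _ _ _ (expR (omega * t * dotrV th th))) => //.
by move=> x; rewrite ger0_norm ?expR_ge0// weight_le.
Qed.

Lemma gibbs_posterior_ge0 t th A : 0 <= gibbs_posterior f omega t Theta prior th A.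
Proof.
by rewrite divr_ge0// Rintegral_ge0// => x _; rewrite expR_ge0.
Qed.

Lemma gibbs_posterior_le1 t th (A : set (R -> R)) : 0 < t ->
  measurable [set theta | A (sieve_fun f theta)] ->
  gibbs_posterior f omega t Theta prior th A <= 1.
Proof.
move=> t0 mA; have mI := measurableI _ _ mTheta mA.
rewrite /gibbs_posterior -/(weight t th _); set den := Rintegral _ Theta _.
have den_ge0 : 0 <= den by apply: Rintegral_ge0 => x _; exact: expR_ge0.
(* A vanishing denominator makes the quotient 0, since the inverse of 0 is 0. *)
have [den0|den_gt0] := eqVneq den 0; first by rewrite den0 invr0 mulr0.
rewrite ler_pdivrMr ?lt_neqAle ?den_ge0 ?andbT 1?eq_sym// mul1r.
apply: fine_le.
- exact: integrable_fin_num (int_weight _ t0 mI).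
- exact: integrable_fin_num (int_weight _ t0 mTheta).
- apply: ge0_subset_integral => //.
  by apply/measurable_EFinP; apply: measurable_funTS; exact: mweight.
Qed.

(** [C] and [r] are chosen before [t], [L], [M], the estimate and the set, so the bound applies
    sample point by sample point and along n. The factor in $L^2$ is the cost of centring the
    denominator at [theta0] instead of the estimate. *)
Lemma gibbs_posterior_le (theta0 : 'rV[R]_K) : prior_density_near prior theta0 ->
  exists C r, [/\ 0 <= C, 0 < r & forall (t L M : R) th (A : set (R -> R)),
    0 < t -> (Num.sqrt t)^-1 <= r -> 0 <= L -> 2 * L <= M ->
    sqdist th theta0 <= L ^+ 2 / t ->
    measurable [set theta | A (sieve_fun f theta)] ->
    (forall theta, A (sieve_fun f theta) -> M ^+ 2 / t <= sqdist theta theta0) ->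
    gibbs_posterior f omega t Theta prior th A <=
      C * expR (2 * omega * L ^+ 2) * expR (- (omega / 8 * M ^+ 2))].
Proof.
move=> /prior_coord_box[C [c [r [C0 c0 r0 box_le box_ge]]]].
have [C' C'0 gauss] : exists2 C', 0 <= C' & forall e, 0 < e ->
    (\int[prior]_x (expR (- (omega / 8 * (sqdist x theta0 / e ^+ 2))))%:E
      <= (C' * e ^+ K)%:E)%E.
  apply: (@gaussian_integral_le _ _ _ _ _ _ C) => //.
  - exact: measurable_dist.
  - by move=> x; exact: dotrV_ge0.
  - by rewrite divr_gt0.
  - move=> s s0; apply: le_trans (box_le s s0); apply: le_measure; rewrite ?inE.
    + rewrite (_ : [set x | _] = setT `&` (fun x => sqdist x theta0) @^-1` `]-oo, s ^+ 2]).
        exact: (measurable_dist theta0).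
      by apply/seteqP; split => x /=; rewrite in_itv/= => // -[].
    + exact: measurable_coord_box.
    + by move=> x /=; exact: dist_le_coord_box.
exists (C' / c * expR (2 * omega * K%:R)), r; split=> //.
  by rewrite !mulr_ge0 ?expR_ge0// invr_ge0 ltW.
move=> t L M th A t0 er L0 LM thL mA hA.
set e := (Num.sqrt t)^-1 in er.
have e0 : 0 < e by rewrite invr_gt0 sqrtr_gt0.
have e2 : e ^+ 2 = t^-1 by rewrite exprVn sqr_sqrtr// ltW.
have te2 : t * e ^+ 2 = 1 by rewrite e2 divff// gt_eqF.
(* The constant dropped from the risk becomes this factor, common to numerator and denominator,
   which cancels at the end. *)
set q := expR (omega * t * dotrV th th).
have q0 : 0 < q by exact: expR_gt0.
have ot0 : 0 <= omega * t by rewrite mulr_ge0// ltW.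
set N := [set theta | A (sieve_fun f theta)] in mA.
have mI := measurableI _ _ mTheta mA.
have ek0 : 0 < e ^+ K by rewrite exprn_gt0.
have num_le : \int[prior]_(theta in Theta `&` N) weight t th theta <=
    q * expR (- (omega / 8 * M ^+ 2)) * (C' * e ^+ K).
  rewrite -lee_fin fineK; last exact: integrable_fin_num (int_weight _ t0 mI).
  have mG : measurable_fun setT
      (fun x => expR (- (omega / 8 * (sqdist x theta0 / e ^+ 2)))).
    apply: measurableT_comp => //; apply: measurableT_comp => //.
    apply: measurable_funM => //; apply: measurable_funM => //.
    exact: measurable_dist.
  have c1 : 0 <= q * expR (- (omega / 8 * M ^+ 2)) by rewrite mulr_ge0 ?expR_ge0.
  apply: (@le_trans _ _ (\int[prior]_x ((q * expR (- (omega / 8 * M ^+ 2)))%:E *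
      (expR (- (omega / 8 * (sqdist x theta0 / e ^+ 2))))%:E))%E); last first.
    rewrite ge0_integralZl_EFin//.
      by rewrite [leRHS]EFinM lee_wpmul2l// gauss.
    exact/measurable_EFinP.
  apply: (@le_trans _ _ (\int[prior]_(x in Theta `&` N)
      ((q * expR (- (omega / 8 * M ^+ 2)))%:E *
      (expR (- (omega / 8 * (sqdist x theta0 / e ^+ 2))))%:E))%E).
    apply: ge0_le_integral => //.
    - by move=> x _; rewrite lee_fin expR_ge0.
    - by apply/measurable_EFinP/measurable_funTS; exact: mweight.
    - apply: measurable_funTS; apply: emeasurable_funM => //.
      exact/measurable_EFinP.
    - move=> x [_ Nx]; rewrite -EFinM lee_fin weightE -/q -[leRHS]mulrA ler_wpM2l ?(ltW q0)//.
      rewrite -expRD ler_expR.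
      have h1 := hA x Nx; have h2 := dist_le2 x th theta0.
      rewrite -!/(sqdist _ _) in h2.
      have h3 : M ^+ 2 <= t * sqdist x theta0.
        by rewrite mulrC -ler_pdivrMr.
      have h4 : t * sqdist th theta0 <= L ^+ 2 by rewrite mulrC -ler_pdivlMr.
      have h5 : 4 * L ^+ 2 <= M ^+ 2 by nra.
      have h6 : t * sqdist x theta0 <= 2 * (t * sqdist x th) + 2 * (t * sqdist th theta0).
        by move: (ler_wpM2l (ltW t0) h2); lra.
      have -> : sqdist x theta0 / e ^+ 2 = t * sqdist x theta0.
        by rewrite e2 invrK mulrC.
      (* With $d$ the squared distance of [x] to [theta0], the right side is at least $td/2-L^2\ge
         td/2-M^2/4\ge td/4$, as $4L^2\le M^2\le td$. Half of $td/4$ gives $M^2/8$, and the other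
         half is kept for the Gaussian integral. *)
      have h7 : M ^+ 2 / 8 + t * sqdist x theta0 / 8 <= t * sqdist x th by lra.
      have := ler_wpM2l (ltW omega_gt0) h7.
      by rewrite -[omega * t * _]mulrA; lra.
  apply: ge0_subset_integral => //.
  - by apply: emeasurable_funM => //; exact/measurable_EFinP.
  - by move=> x _; rewrite mule_ge0// lee_fin expR_ge0.
(* On the box of half-side $e=t^{-1/2}$ the squared distance to [theta0], times $t$, is at most $K$,
   so the exponent is at most $\omega(2K+2L^2)$; [er] puts this box in the range of the lower bound
   on the prior. *)
have den_ge : q * expR (- (omega * (2 * K%:R + 2 * L ^+ 2))) * (c * e ^+ K) <=
    \int[prior]_(theta in Theta) weight t th theta.
  rewrite -lee_fin fineK; last exact: integrable_fin_num (int_weight _ t0 mTheta).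
  have mB := measurable_coord_box theta0 e.
  have mTB := measurableI _ _ mTheta mB.
  have priorTB : (prior (coord_box theta0 e) <= prior (Theta `&` coord_box theta0 e))%E.
    have C0' : prior (~` Theta) = 0%E.
      by rewrite probability_setC// prior_Theta subee.
    rewrite (measureDI prior mB mTheta) setIC.
    rewrite [X in (X + _ <= _)%E](_ : _ = 0%E) ?add0e//.
    apply/eqP; rewrite -measure_le0 -C0'; apply: le_measure; rewrite ?inE//.
    + exact: measurableD.
    + exact: measurableC.
  have c1 : 0 <= q * expR (- (omega * (2 * K%:R + 2 * L ^+ 2))).
    by rewrite mulr_ge0 ?expR_ge0// ltW.
  apply: (@le_trans _ _ (\int[prior]_(x in Theta `&` coord_box theta0 e)
     (q * expR (- (omega * (2 * K%:R + 2 * L ^+ 2))))%:E)%E).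
    rewrite integral_cst// EFinM lee_wpmul2l//.
    exact: le_trans (box_ge e e0 er) priorTB.
  apply: (@le_trans _ _ (\int[prior]_(x in Theta `&` coord_box theta0 e)
     (weight t th x)%:E)%E); last first.
    apply: ge0_subset_integral => //.
    - by apply/measurable_EFinP/measurable_funTS; exact: mweight.
    - by move=> x _; rewrite lee_fin expR_ge0.
  apply: ge0_le_integral => //.
  - by apply/measurable_EFinP/measurable_funTS; exact: mweight.
  - move=> x [_ Bx]; rewrite lee_fin weightE -/q ler_wpM2l ?(ltW q0)//.
    rewrite ler_expR lerN2 -mulrA ler_wpM2l ?(ltW omega_gt0)//.
    have h1 := coord_box_dist_le Bx; have h2 := dist_le2 x theta0 th.
    rewrite -!/(sqdist _ _) in h1 h2.
    have h3 : sqdist theta0 th = sqdist th theta0.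
      by rewrite /sqdist -opprB /dotrV; apply: eq_bigr => i _; rewrite !mxE; ring.
    have h4 : t * sqdist th theta0 <= L ^+ 2 by rewrite mulrC -ler_pdivlMr.
    have h5 : t * sqdist x theta0 <= K%:R.
      by move: (ler_wpM2l (ltW t0) h1); rewrite mulrCA te2 mulr1.
    by move: (ler_wpM2l (ltW t0) h2); rewrite h3; lra.
rewrite /gibbs_posterior -/(weight t th _).
have pos : 0 < q * expR (- (omega * (2 * K%:R + 2 * L ^+ 2))) * (c * e ^+ K).
  by rewrite !mulr_gt0 ?expR_gt0.
rewrite ler_pdivrMr; last exact: lt_le_trans den_ge.
apply: (le_trans num_le).
have k0 : 0 <= C' / c * expR (2 * omega * K%:R) * expR (2 * omega * L ^+ 2) *
    expR (- (omega / 8 * M ^+ 2)).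
  by rewrite !mulr_ge0 ?expR_ge0// invr_ge0 ltW.
apply: le_trans (ler_wpM2l k0 den_ge).
rewrite le_eqVlt; apply/orP; left; apply/eqP.
have -> : expR (- (omega * (2 * K%:R + 2 * L ^+ 2))) =
    (expR (2 * omega * K%:R))^-1 * (expR (2 * omega * L ^+ 2))^-1.
  by rewrite -!expRN -expRD; congr expR; ring.
have := lt0r_neq0 (expR_gt0 (2 * omega * K%:R)).
have := lt0r_neq0 (expR_gt0 (2 * omega * L ^+ 2)).
move: (expR (2 * _ * K%:R)) (expR (2 * _ * L ^+ 2)) (expR (- _)) => u v w *.
by field; apply/and3P; split=> //; rewrite gt_eqF.
Qed.

End gibbs_posterior.

(** * Concentration *)

(** The integral of a nonnegative function is a supremum over the simple functions below it, hence
    monotone without measurability. This spares a proof that the posterior mass is measurable in the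
    sample point. *)
Lemma ge0_le_integral_nonmeasurable d (T : measurableType d) (R : realType)
    (m : {measure set T -> \bar R}) (f g : T -> \bar R) :
  (forall x, 0 <= f x)%E -> (forall x, f x <= g x)%E ->
  (\int[m]_x f x <= \int[m]_x g x)%E.
Proof.
move=> f0 fg; have g0 x : (0 <= g x)%E by exact: le_trans (fg x).
rewrite !ge0_integralTE//; apply: ereal_sup_le => _ /= [h hf <-].
exists h => // x.
exact: le_trans (hf x) (fg x).
Qed.

Section sieve_interval.
Variables (R : realType) (a b : R) (K : nat) (f : 'I_K -> R -> R).
Hypothesis Hf : sieve a b f.
Local Notation D := (`[a, b]%classic : set R).

Lemma interval_away_from0 : ~ D 0 -> a < b -> exists2 delta : R, 0 < delta &
  forall k x, `|x| < delta + delta -> f k x = 0.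
Proof.
move=> D0 ab.
have [a0|a0] := ltP 0 a.
  exists (a / 2) => [|k x xa]; first by rewrite divr_gt0.
  apply: (sieve_vanish Hf); rewrite /= in_itv/= => /andP[ax _].
  by have := ler_norm x; lra.
have [b0|b0] := ltP b 0.
  exists (- b / 2) => [|k x xa]; first by rewrite divr_gt0// oppr_gt0.
  apply: (sieve_vanish Hf); rewrite /= in_itv/= => /andP[_ xb].
  by have := ler_norm (- x); rewrite normrN; lra.
by exfalso; apply: D0; rewrite /= in_itv/= a0 b0.
Qed.

(** A function of unit norm is nonzero at some [x0] in [D], which gives $F_1\ge|f(x_0)|>0$. Only
    this lower bound enters, so no case distinction on the finiteness of [sieve_F1] arises. *)
Lemma sampling_condition_bounded (Delta : nat -> R) : (1 <= K)%N ->
  (forall n, 0 < Delta n) -> sampling_condition a b f Delta ->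
  exists2 C, 0 <= C & \forall n \near \oo, n%:R * Delta n ^+ 3 <= C.
Proof.
move=> K1 D0 [C HC]; pose k0 : 'I_K := Ordinal K1.
have [x0 Dx0 fx0] : exists2 x0, D x0 & f k0 x0 != 0.
  apply: contrapT => h; have := sieve_orthonormal Hf k0 k0.
  have -> : (\int[lebesgue_measure]_(x in D) (f k0 x * f k0 x)%:E = 0)%E.
    apply: integral0_eq => x Dx; have [->|fx] := eqVneq (f k0 x) 0.
      by rewrite mulr0.
    by exfalso; apply: h; exists x.
  by rewrite eqxx => -[] /eqP; rewrite eq_sym oner_eq0.
pose s := `|f k0 x0|; have s0 : 0 < s by rewrite normr_gt0.
have F1s : (s%:E <= sieve_F1 a b f)%E.
  rewrite /sieve_F1; apply: (@le_trans _ _ (ereal_sup [set `|f k0 x|%:E | x in D]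
   + \int[lebesgue_measure]_(x in D) `|support_deriv (f k0) x|%:E)%E); last first.
    exact: (le_bigmax _ (fun k => (ereal_sup [set `|f k x|%:E | x in D]
   + \int[lebesgue_measure]_(x in D) `|support_deriv (f k) x|%:E)%E) k0).
  rewrite -[leLHS]adde0; apply: leeD; last by apply: integral_ge0 => x _; rewrite lee_fin.
  by apply: ereal_sup_ubound; exists x0.
exists (`|C| / s ^+ 2); first by rewrite divr_ge0// sqr_ge0.
apply: filterS HC => n; rewrite ge_max => /andP[h _].
rewrite ler_pdivlMr ?exprn_gt0// -lee_fin.
apply: (@le_trans _ _ C%:E); last by rewrite lee_fin ler_norm.
apply: le_trans h; rewrite EFinM muleC lee_wpmul2r//.
  by rewrite lee_fin mulr_ge0// exprn_ge0// ltW.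
rewrite expr2 EFinM expe2; apply: lee_pmul => //; rewrite lee_fin; exact: ltW.
Qed.

End sieve_interval.

Section estimator_mse.
Variables (R : realType) (d : measure_display) (T : measurableType d).
Variables (P : probability T R) (X : R -> {RV P >-> R}).
Variables (mu sigma : R) (Psi : {measure set R -> \bar R}) (psi : R -> R).
Variables (Delta : nat -> R) (a b : R) (K : nat) (f : 'I_K -> R -> R).
Hypothesis HX : levy_process X mu sigma Psi.
Hypothesis Hpsi : levy_density Psi psi.
Hypothesis Hsmall : small_time_property X psi.
Hypothesis HDelta_gt0 : forall n, 0 < Delta n.
Hypothesis HDelta : Delta n @[n --> \oo] --> 0.
Hypothesis Hab : a < b.
Hypothesis HD0 : ~ `[a, b]%classic 0.
Hypothesis Hf : sieve a b f.

(** After multiplication by $t=n\Delta$ the variance part becomes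
    $2\Delta^{-1}\mathsf{E}f_k^2(X_\Delta)$, which is bounded, and the squared bias $O(\Delta^2)$
    becomes $O(n\Delta^3)$. *)
Lemma theta_hat_mse k : exists2 C, 0 <= C & forall n, (0 < n)%N ->
  n%:R * Delta n * \int[P]_w (theta_hat X f (Delta n) n w ord0 k
     - theta_perp a b f psi ord0 k) ^+ 2 <= C * (1 + n%:R * Delta n ^+ 3).
Proof.
have [delta delta0 fdelta] := interval_away_from0 Hf HD0 Hab.
have [B [B0 fB]] := sieve_uniformly_bounded Hf.
have mf := sieve_measurable Hf k.
have HPsi := levy_measureP HX.
have mf2 : measurable_fun setT (fun x => f k x ^+ 2) by exact: measurable_funX.
have f2B x : `|f k x ^+ 2| <= B ^+ 2 by rewrite normrX lerXn2r// nnegrE.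
have [C1 hC1] := small_time_rate HPsi Hpsi Hsmall HDelta_gt0 HDelta delta0 mf
  (fB k) (fdelta k).
have [|C2 hC2] := small_time_rate HPsi Hpsi Hsmall HDelta_gt0 HDelta delta0 mf2
  f2B.
  by move=> x /(fdelta k) ->; rewrite expr0n.
have perpE : theta_perp a b f psi ord0 k =
    \int[lebesgue_measure]_x (f k x * psi x).
  rewrite mxE [LHS]Rintegral_mkcond; apply: eq_Rintegral => x _.
  rewrite patchE; case: ifPn => //; rewrite notin_setE => nD.
  by rewrite (sieve_vanish Hf)// mul0r.
have [Dmax hDmax] : exists Dmax, forall n, Delta n <= Dmax.
  have /cvgrPdist_le/(_ _ ltr01)[n0 _ n0P] := HDelta.
  exists (1 + \sum_(i < n0) Delta i) => n.
  have S0 : 0 <= \sum_(i < n0) Delta i by apply: sumr_ge0 => i _; exact: ltW.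
  have [n0n|nn0] := leqP n0 n.
    have := n0P n n0n; rewrite /= sub0r normrN => h.
    by have := ler_norm (Delta n); lra.
  rewrite (bigD1 (Ordinal nn0))//= addrCA lerDl addr_ge0// sumr_ge0// => i _.
  exact: ltW.
set I2 := \int[lebesgue_measure]_x (f k x ^+ 2 * psi x) in hC2.
have Dmax0 : 0 <= Dmax by exact: le_trans (ltW (HDelta_gt0 0)) (hDmax 0).
have W0 : 0 <= `|I2| + `|C2| * Dmax by rewrite addr_ge0// mulr_ge0.
exists (2 * (`|I2| + `|C2| * Dmax) + 2 * C1 ^+ 2).
  by have := sqr_ge0 C1; lra.
move=> n n0; have nR : 0 < n%:R :> R by rewrite ltr0n.
have D0 := HDelta_gt0 n.
have h := empirical_mean_mse HX D0 (theta_perp a b f psi ord0 k) mf (fB k) n0.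
have -> : \int[P]_w (theta_hat X f (Delta n) n w ord0 k
     - theta_perp a b f psi ord0 k) ^+ 2 =
  \int[P]_w ((n%:R * Delta n)^-1 * (\sum_(i < n) f k (increment X (Delta n) i w))
     - theta_perp a b f psi ord0 k) ^+ 2.
  by apply: eq_Rintegral => w _; rewrite /theta_hat mxE.
have t0 : 0 <= n%:R * Delta n by rewrite mulr_ge0// ltW.
apply: (le_trans (ler_wpM2l t0 h)); rewrite mulrDr.
set v := \int[P]_w f k (X (Delta n) w) ^+ 2.
set m := \int[P]_w f k (X (Delta n) w).
have -> : n%:R * Delta n * (2 * ((n%:R * Delta n ^+ 2)^-1 * v)) = 2 * ((Delta n)^-1 * v).
  by field; rewrite !gt_eqF.
have vle : (Delta n)^-1 * v <= `|I2| + `|C2| * Dmax.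
  have := hC2 n; rewrite -/v ler_norml => /andP[_ h1].
  have h2 : C2 * Delta n <= `|C2| * Dmax.
    by apply: (le_trans (ler_wpM2r (ltW D0) (ler_norm C2))); rewrite ler_wpM2l.
  by have := ler_norm I2; lra.
have ble : ((Delta n)^-1 * m - theta_perp a b f psi ord0 k) ^+ 2 <= C1 ^+ 2 * Delta n ^+ 2.
  rewrite perpE -exprMn -[leLHS]real_normK ?num_real//.
  by rewrite lerXn2r ?nnegrE ?hC1// (le_trans _ (hC1 n)).
have b2 := ler_wpM2l t0 ble.
have nD3 : 0 <= n%:R * Delta n ^+ 3 by rewrite mulr_ge0// exprn_ge0// ltW.
have E : n%:R * Delta n * (C1 ^+ 2 * Delta n ^+ 2) = C1 ^+ 2 * (n%:R * Delta n ^+ 3) by ring.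
rewrite E in b2; have C10 := sqr_ge0 C1.
have W1 : 0 <= (`|I2| + `|C2| * Dmax) * (n%:R * Delta n ^+ 3) by rewrite mulr_ge0.
rewrite mulrDr mulr1 mulrDl.
have -> : n%:R * Delta n * (2 * ((Delta n)^-1 * m - theta_perp a b f psi ord0 k) ^+ 2) =
  2 * (n%:R * Delta n * ((Delta n)^-1 * m - theta_perp a b f psi ord0 k) ^+ 2) by ring.
by lra.
Qed.

End estimator_mse.

Lemma ler_expRN_inv (R : realType) (x : R) : 0 < x -> expR (- x) <= x^-1.
Proof.
move=> x0; rewrite expRN lef_pV2 ?posrE ?expR_gt0//.
by have := expR_ge1Dx x; lra.
Qed.

(** The sets [A n] are constrained only through the sieve functions they contain, which lets the
    centre be any function at the right distance from these, in the sieve or not. *)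
Lemma gibbs_posterior_concentration (R : realType) (d : measure_display)
    (T : measurableType d) (P : probability T R) (K : nat) (f : 'I_K -> R -> R)
    (omega : R) (Theta : set 'rV[R]_K) (prior : probability 'rV[R]_K R)
    (theta0 : 'rV[R]_K) (t : nat -> R) (th : nat -> T -> 'rV[R]_K) (C : R)
    (M : nat -> R) (A : nat -> set (R -> R)) :
  0 < omega -> measurable Theta -> prior Theta = 1%E ->
  prior_density_near prior theta0 ->
  t n @[n --> \oo] --> +oo -> M n @[n --> \oo] --> +oo -> 0 <= C ->
  (forall n k, measurable_fun setT (fun w => th n w ord0 k)) ->
  (forall n k, exists B, forall w, `|th n w ord0 k| <= B) ->
  (\forall n \near \oo, forall k,
    t n * \int[P]_w (th n w ord0 k - theta0 ord0 k) ^+ 2 <= C) ->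
  (forall n theta, A n (sieve_fun f theta) <->
    M n * (Num.sqrt (t n))^-1 < Num.sqrt (dotrV (theta - theta0) (theta - theta0))) ->
  ('E_P[fun w => gibbs_posterior f omega (t n) Theta prior (th n w) (A n)])%E
    @[n --> \oo] --> 0%E.
Proof.
move=> omega0 mTheta prior1 Hdens ht hM C0 mth bth mse hA.
have [C1 [r [C10 r0 post_le]]] :=
  gibbs_posterior_le f omega0 mTheta prior1 Hdens.
pose Pi n w := gibbs_posterior f omega (t n) Theta prior (th n w) (A n).
pose EPi n := (\int[P]_w (Pi n w)%:E)%E.
have -> : (fun n => 'E_P[Pi n])%E = EPi by apply/funext => n; rewrite unlock.
have EPi0 n : (0 <= EPi n)%E.
  by apply: integral_ge0 => w _; rewrite lee_fin gibbs_posterior_ge0.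
suff small e : 0 < e -> \forall n \near \oo, (EPi n <= e%:E)%E.
  have fin : \forall n \near \oo, EPi n \is a fin_num.
    have := small 1 ltr01; apply: filterS => n h.
    by rewrite ge0_fin_numE// (le_lt_trans h)// ltry.
  apply/fine_cvgP; split=> //; apply/cvgr0Pnorm_le => e e0.
  near=> n; rewrite /= ger0_norm ?fine_ge0// -lee_fin fineK; last by near: n.
  by near: n; exact: small.
move=> e0; have e20 : 0 < e / 2 by rewrite divr_gt0.
pose KC := K%:R * C; have KC0 : 0 <= KC by rewrite mulr_ge0.
(* [L] is chosen so that the estimator leaves the [L / sqrt t] ball with
   probability at most [e / 2]. *)
pose L := 1 + 2 * KC / e.
have L1 : 1 <= L by rewrite lerDl divr_ge0 ?mulr_ge0// ltW.
have L0 : 0 < L by lra.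
have KCL : KC / L ^+ 2 <= e / 2.
  rewrite ler_pdivrMr ?exprn_gt0//.
  have h : KC <= e / 2 * L.
    rewrite /L mulrDr mulr1 (_ : e / 2 * (2 * KC / e) = KC); first by lra.
    by field; rewrite gt_eqF.
  apply: (le_trans h); rewrite ler_wpM2l ?(ltW e20)// expr2 ler_peMl ?(ltW L0)//.
pose C2 := C1 * expR (2 * omega * L ^+ 2).
have C20 : 0 <= C2 by rewrite mulr_ge0// expR_ge0.
near=> n.
have t0 : 0 < t n.
  by apply: (@lt_le_trans _ _ 1) => //; near: n; move/cvgryPge: ht; exact.
have tr : r^-1 ^+ 2 <= t n by near: n; move/cvgryPge: ht; exact.
have ML : 2 * L <= M n by near: n; move/cvgryPge: hM; exact.
(* Chosen so that $C_2 e^{-\omega M^2/8}\le 8C_2/(\omega M^2)\le e/2$, given $M\ge 1$. *)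
have MC : 16 * C2 / (omega * e) <= M n by near: n; move/cvgryPge: hM; exact.
have M1 : 1 <= M n by lra.
have er : (Num.sqrt (t n))^-1 <= r.
  rewrite -[r]invrK lef_pV2 ?posrE ?sqrtr_gt0 ?invr_gt0//.
  rewrite -(ger0_norm (ltW _ : 0 <= r^-1)) ?invr_gt0// -sqrtr_sqr.
  by rewrite ler_wsqrtr.
have msen : forall k, t n * \int[P]_w (th n w ord0 k - theta0 ord0 k) ^+ 2 <= C.
  by near: n.
have eps0 : 0 <= M n * (Num.sqrt (t n))^-1.
  by rewrite mulr_ge0 ?invr_ge0 ?sqrtr_ge0//; lra.
have eps2 : (M n * (Num.sqrt (t n))^-1) ^+ 2 = M n ^+ 2 / t n.
  by rewrite exprMn exprVn sqr_sqrtr// ltW.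
have hA2 theta : A n (sieve_fun f theta) <->
    M n ^+ 2 / t n < dotrV (theta - theta0) (theta - theta0).
  rewrite hA -eps2 -(ltr_pXn2r (n := 2)) ?nnegrE ?sqrtr_ge0//.
  by rewrite sqr_sqrtr ?dotrV_ge0.
have mA : measurable [set theta | A n (sieve_fun f theta)].
  rewrite (_ : [set theta | _] = setT `&` (fun theta =>
      dotrV (theta - theta0) (theta - theta0)) @^-1` `]M n ^+ 2 / t n, +oo[).
    by apply: measurable_dist.
  apply/seteqP; split => theta /=; rewrite in_itv/= andbT.
    by move=> /hA2.
  by move=> [_ /hA2].
pose B := C2 * expR (- (omega / 8 * M n ^+ 2)).
have B_e : B <= e / 2.
  have x0 : 0 < omega / 8 * M n ^+ 2 by rewrite mulr_gt0 ?divr_gt0 ?exprn_gt0//; lra.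
  apply: (le_trans (ler_wpM2l C20 (ler_expRN_inv x0))).
  rewrite ler_pdivrMr//.
  have h : 16 * C2 <= M n * (omega * e) by rewrite -ler_pdivrMr// mulr_gt0.
  have h2 : omega * e * M n <= omega * e * M n ^+ 2.
    have oe0 : 0 <= omega * e by rewrite mulr_ge0// ltW.
    by rewrite ler_wpM2l// expr2 ler_peMl//; lra.
  by lra.
pose dev w := dotrV (th n w - theta0) (th n w - theta0).
(* Markov's inequality in pointwise form: when the estimator leaves the ball, the first term exceeds
   1, the trivial bound on the posterior mass. *)
have Pi_le w : Pi n w <= t n / L ^+ 2 * dev w + B.
  have dev0 : 0 <= dev w by exact: dotrV_ge0.
  have tL0 : 0 <= t n / L ^+ 2 by rewrite divr_ge0 ?sqr_ge0// ltW.
  have [devL|devL] := leP (dev w) (L ^+ 2 / t n).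
    apply: (@le_trans _ _ B); last by rewrite lerDr mulr_ge0.
    by apply: post_le => // [|theta /hA2]; exact: ltW.
  apply: (@le_trans _ _ 1); first exact: gibbs_posterior_le1.
  rewrite -[1]addr0 lerD//; last by rewrite mulr_ge0// expR_ge0.
  rewrite -ler_pdivrMl ?divr_gt0 ?exprn_gt0// mulr1 invf_div.
  exact: ltW.
pose sq k w := (th n w ord0 k - theta0 ord0 k) ^+ 2.
have msq k : measurable_fun setT (sq k).
  by apply: measurable_funX; exact: measurable_funB.
have /choice[Bk hBk] : forall k, exists B, forall w, `|sq k w| <= B.
  move=> k; have [Bt hBt] := bth n k.
  exists ((Bt + `|theta0 ord0 k|) ^+ 2) => w; rewrite normrX.
  rewrite lerXn2r ?nnegrE ?addr_ge0//; first exact: le_trans (hBt w).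
  by rewrite (le_trans (ler_normB _ _))// lerD2r.
have devE w : dev w = \sum_(k < K) sq k w.
  by rewrite /dev /dotrV; apply: eq_bigr => k _; rewrite !mxE /sq expr2.
have isq k : P.-integrable setT (EFin \o sq k).
  exact: (probability_bounded_integrable P (msq k) (hBk k)).
have [Isum sumE] := Rintegral_sum (index_enum 'I_K) measurableT isq.
have Icst (x : R) : P.-integrable setT (EFin \o cst x).
  exact: (@probability_bounded_integrable _ _ _ _ _ `|x|).
have IZ (x : R) : P.-integrable setT (EFin \o (fun w => x * \sum_(k < K) sq k w)).
  by apply: (eq_integrable _ (fun w => x%:E * (\sum_(k < K) sq k w)%:E)%E) => //;
    exact: integrableZl.
apply: (@le_trans _ _ (\int[P]_w (t n / L ^+ 2 * (\sum_(k < K) sq k w) + B)%:E)%E).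
  apply: ge0_le_integral_nonmeasurable => w.
    by rewrite lee_fin gibbs_posterior_ge0.
  by rewrite lee_fin -devE.
have IS : P.-integrable setT (EFin \o (fun w => t n / L ^+ 2 * (\sum_(k < K) sq k w) + B)).
  exact: (integrableD measurableT (IZ _) (Icst _)).
rewrite -[leLHS]fineK; last exact: integrable_fin_num IS.
rewrite lee_fin -/(Rintegral _ _ _) RintegralD//; last exact: Icst.
rewrite RintegralZl// sumE.
rewrite Rintegral_cst// [fine _](congr1 fine (probability_setT P)) mulr1.
have : t n / L ^+ 2 * (\sum_(k < K) \int[P]_w sq k w) <= KC / L ^+ 2.
  rewrite mulrAC ler_wpM2r ?invr_ge0 ?sqr_ge0// mulr_sumr /KC.
  apply: (@le_trans _ _ (\sum_(k < K) C)); first by apply: ler_sum => k _; exact: msen.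
  by rewrite sumr_const card_ord mulr_natl.
by lra.
Unshelve. all: by end_near. Qed.

Theorem theorem1 (R : realType) (d : measure_display) (T : measurableType d)
    (P : probability T R) (X : R -> {RV P >-> R})
    (mu sigma : R) (Psi : {measure set R -> \bar R}) (psi : R -> R)
    (Delta : nat -> R) (a b : R) (K : nat) (f : 'I_K -> R -> R)
    (Theta : set 'rV[R]_K) (prior : probability 'rV[R]_K R) (omega : R)
    (HX : levy_process X mu sigma Psi)
    (Hpsi : levy_density Psi psi)
    (Hsmall : small_time_property X psi)
    (HDelta_gt0 : forall n, 0 < Delta n)
    (HDelta : Delta n @[n --> \oo] --> 0)
    (Ht : n%:R * Delta n @[n --> \oo] --> +oo)
    (Hab : a < b)
    (HD0 : ~ `[a, b]%classic 0)
    (HK : (1 <= K)%N)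
    (Hf : sieve a b f)
    (Homega : 0 < omega)
    (Hsampling : sampling_condition a b f Delta)
    (HTheta : measurable Theta)
    (Hprior : prior Theta = 1%E)
    (Hdensity : prior_density_near prior (theta_perp a b f psi)) :
  let t n := n%:R * Delta n in
  let eps n := (Num.sqrt (t n))^-1 in
  let Pi n w :=
    gibbs_posterior f omega (t n) Theta prior (theta_hat X f (Delta n) n w) in
  let concentrates_at g := forall M : nat -> R, M n @[n --> \oo] --> +oo ->
    ('E_P[fun w =>
       Pi n w [set h | ((M n * eps n)%:E < L2norm a b (h \- g)%R)%E]])%E
      @[n --> \oo] --> 0%E in
  concentrates_at (sieve_fun f (theta_perp a b f psi)) /\
  (in_sieve_span a b f psi -> concentrates_at psi).
Proof.
move=> t eps Pi concentrates_at.
set theta0 := theta_perp a b f psi in concentrates_at *.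
have [mpsi _ _] := Hpsi.
have [C3 C30 HC3] := sampling_condition_bounded Hf HK HDelta_gt0 Hsampling.
have /choice[Ck HCk] : forall k, exists C, 0 <= C /\ forall n, (0 < n)%N ->
    n%:R * Delta n * \int[P]_w (theta_hat X f (Delta n) n w ord0 k
      - theta0 ord0 k) ^+ 2 <= C * (1 + n%:R * Delta n ^+ 3).
  move=> k; have [C C0 HC] := theta_hat_mse HX Hpsi Hsmall HDelta_gt0 HDelta
    Hab HD0 Hf k.
  by exists C.
have [B [B0 fB]] := sieve_uniformly_bounded Hf.
(* Both conclusions depend on the centre only through its $L_2$ distances to sieve functions. *)
have main g : (forall theta, L2norm a b (sieve_fun f theta \- g)%R =
    (Num.sqrt (dotrV (theta - theta0) (theta - theta0)))%:E) -> concentrates_at g.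
  move=> Hg M hM.
  apply: (@gibbs_posterior_concentration R d T P K f omega Theta prior theta0 t
    (fun n => theta_hat X f (Delta n) n) ((\sum_(k < K) Ck k) * (1 + C3)) M
    (fun n => [set h | ((M n * eps n)%:E < L2norm a b (h \- g)%R)%E])) => //.
  - by rewrite mulr_ge0 ?addr_ge0// sumr_ge0// => k _; case: (HCk k).
  - move=> n k; rewrite (_ : (fun w => _) = fun w => (n%:R * Delta n)^-1 *
      \sum_(i < n) f k (increment X (Delta n) i w)); last first.
      by apply/funext => w; rewrite mxE.
    apply: measurable_funM => //; apply: measurable_sum => i.
    apply: (measurableT_comp (sieve_measurable Hf k)).
    exact: measurable_funB.
  - move=> n k; exists (`|(n%:R * Delta n)^-1| * \sum_(i < n) B) => w.
    rewrite mxE normrM ler_wpM2l// (le_trans (ler_norm_sum _ _ _))// ler_sum//.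
  - near=> n => k; have [Ck0 Ckn] := HCk k.
    apply: (le_trans (Ckn n _)); first by near: n; exact: nbhs_infty_gt.
    apply: ler_pM => //.
    + by rewrite addr_ge0// mulr_ge0// exprn_ge0// ltW.
    + by rewrite (bigD1 k)//= lerDl sumr_ge0// => j _; case: (HCk j).
    + by rewrite lerD2l; near: n.
  - by move=> n theta /=; rewrite Hg lte_fin.
have perp : concentrates_at (sieve_fun f theta0).
  by apply: main => theta; rewrite sieve_funB L2norm_sieve_fun.
(* For [psi] in the span, the distances to [psi] are those to its sieve representative, whose
   coefficients are [theta0]. *)
split=> // -[theta' psiE]; apply: main => theta.
rewrite (L2norm_in_span Hf mpsi psiE) sieve_funB L2norm_sieve_fun//.
by rewrite -(theta_perp_in_span Hf mpsi psiE).
Unshelve. all: by end_near. Qed.
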